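(* One has \[ \log 2\le \liminf_{n\to\infty}\frac{\log N(n)}{n/\log n}\le\limsup_{n\to\infty}\frac{\log N(n)}{n/\log n}\le 2\log 2 . \] In particular, if the limit $C_N:=\lim_{n\to\infty}\frac{\log N(n)}{n/\log n}$ exists, then $C_N\in[\log 2,2\log 2]$.
   Context: For an integer $n\ge 1$ let $X_n=\{2,3,\ldots,n+1\}$. A truncated residue profile of length $n$ is a tuple $r=(r_2,\ldots,r_n)$ with $r_k\in\mathbb Z/k\mathbb Z$ for each $2\le k\le n$ (the empty tuple if $n=1$). Its survivor set is \[ S_n(r)=\{m\in X_n:\ m\not\equiv r_k\pmod k\text{ for every } 2\le k<m\}. \] Let $\mathcal F_n=\{S_n(r): r \text{ a truncated profile of length } n\}$ and $N(n)=|\mathcal F_n|$ (the number of distinct survivor sets). *)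

(* Defs.v *)
From HB Require Import structures.
From mathcomp Require Import all_boot all_order all_algebra.
From mathcomp Require Import all_classical all_reals all_analysis.
Set Implicit Arguments.
Unset Strict Implicit.
Unset Printing Implicit Defensive.
Import Order.TTheory GRing.Theory Num.Theory.
Local Open Scope ring_scope.

(* The moduli 2 <= k <= n are indexed by i : 'I_n.-1 through k = i.+2, so that
   r i : 'Z_i.+2 is the residue r_k in Z/kZ ('Z_k is Z/kZ only for 2 <= k). *)
Definition profile (n : nat) : finType :=
  {dffun forall i : 'I_n.-1, 'Z_i.+2}.

(* Subsets of X_n = {2, ..., n + 1} are represented inside
   'I_n.+2 = {0, ..., n + 1}, for 1 <= n. *)
Definition survivor (n : nat) (r : profile n) : {set 'I_n.+2} :=
  [set m : 'I_n.+2 | (2 <= m)%N &&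
     [forall i : 'I_n.-1, (i.+2 < m)%N ==> (m%:R != r i :> 'Z_i.+2)]].

Definition survivor_sets (n : nat) : {set {set 'I_n.+2}} :=
  [set survivor r | r : profile n].

Definition num_survivor_sets (n : nat) : nat := #|survivor_sets n|.

(* The values at n = 0, 1, where n / log n is degenerate, are irrelevant to the
   limits. *)
Definition log_ratio (R : realType) (n : nat) : R :=
  ln (num_survivor_sets n)%:R / (n%:R / ln n%:R).

(* Main.v *)
Require Import Defs.
From HB Require Import structures.
From mathcomp Require Import all_boot all_order all_algebra.
From mathcomp Require Import all_classical all_reals all_analysis.
From mathcomp Require Import zify ring lra.
Import Order.TTheory GRing.Theory Num.Theory.
Import numFieldNormedType.Exports.
Local Open Scope ring_scope.

(** Write [N n] for the number of survivor sets.

    Upper bound. The survivors [m > K] avoid one residue class modulo every prime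
    up to [K], and by the Chinese remainder theorem these classes are those of
    [- c] for a single [c < K!]. So, apart from numbers up to [K], a survivor set
    lies in a translate of the set of integers of ]c, c + n + 1] without prime
    factor up to [K]. Selberg's sieve ([selberg_sieve]) bounds the number of those
    integers by [(n + 1) / ln K + (K + 1) ^ 2], whence
    [N n <= K! * 2 ^ ((n + 1) / ln K + O(K ^ 2))]. Taking [K = n ^ a] with [a]
    slightly below one half gives the constant [2 ln 2].

    Lower bound. Suppose that [x + q] is prime for every [q] in a set [T]. With
    all residues equal to that of [- x], no element of [T] is removed. If moreover
    there are distinct moduli [k q < q] such that [k q] divides no difference
    [q - q'], then changing the residue modulo [k q] to that of [q] removes [q]
    and no other element of [T]; hence [N n >= 2 ^ #|T|]
    ([num_survivor_sets_ge]). When the elements of [T] exceed [2 w] and [T] is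
    small compared with [w], such moduli can be chosen greedily in ]w, 2 w]. It
    remains to find a window of length about [n] with [(1 - o(1)) n / ln n]
    primes. The prime number theorem is not needed, since the window may be
    translated: by Mertens' estimate for the sum of [ln p / p], every interval
    [A, C A], with [C] a constant depending on [e], contains an [M] with
    [theta M >= (1 - e) M] ([theta_large]). Applied to [A] of size [n ^ (1 + e)]
    it yields an [M], much larger than [n ln n], with [(1 - O(e)) M / ln n]
    primes up to it, and by the pigeonhole principle one of the windows of length
    about [n] that tile [1, M] has its share of them. *)

(** * Elementary bounds on logarithms and factorials *)

Lemma ln_natS_le (R : realType) (m : nat) :
  ln (m.+2%:R : R) - ln m.+1%:R <= (m.+1%:R)^-1.
Proof.
rewrite -ln_div ?posrE// -[in X in X / _]addn1 natrD mulrDl divff// div1r.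
by apply: le_ln1Dx; apply: lt_trans (ltrN10 _) _; rewrite invr_gt0.
Qed.

Lemma ln_natS_ge (R : realType) (m : nat) :
  (m.+2%:R)^-1 <= ln (m.+2%:R : R) - ln m.+1%:R.
Proof.
have h : ln (m.+1%:R : R) - ln m.+2%:R <= - m.+2%:R^-1.
  rewrite -ln_div ?posrE//.
  have -> : m.+1%:R / m.+2%:R = 1 + (- m.+2%:R^-1) :> R.
    by rewrite -[in LHS](addrK 1 m.+1%:R) natr1 mulrDl divff// mulN1r.
  by apply: le_ln1Dx; rewrite ltrN2 invf_lt1// ltr1n.
by rewrite -lerN2 opprB.
Qed.

Lemma ln_nat_ge0 (R : realType) (m : nat) : 0 <= ln (m%:R : R).
Proof.
case: m => [|m]; first by rewrite ln0.
by apply: ln_ge0; rewrite ler1n.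
Qed.

Lemma ln_nat_gt0 (R : realType) (m : nat) : (1 < m)%N -> 0 < ln (m%:R : R).
Proof. by move=> m1; apply: ln_gt0; rewrite ltr1n. Qed.

Lemma ln_nat_le (R : realType) (m n : nat) :
  (0 < m)%N -> (m <= n)%N -> ln (m%:R : R) <= ln n%:R.
Proof.
move=> m0 mn; rewrite ler_ln ?posrE ?ltr0n ?ler_nat//; exact: leq_trans mn.
Qed.

Lemma ln_fact_le (R : realType) (n : nat) : ln (n`!%:R : R) <= n%:R * ln n%:R.
Proof.
elim: n => [|[|n] IH]; [by rewrite mul0r fact0 ln1|by rewrite ln1 mulr0|].
rewrite factS natrM lnM ?posrE ?ltr0n ?fact_gt0// -[X in _ <= X * _]natr1 mulrDl mul1r addrC.
by rewrite lerD2r (le_trans IH)// ler_wpM2l// ln_nat_le.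
Qed.

Lemma ln_fact_ge (R : realType) (n : nat) :
  n%:R * ln n%:R - n%:R <= ln (n`!%:R : R).
Proof.
elim: n => [|n IH]; first by rewrite mul0r fact0 ln1 subr0.
rewrite factS natrM lnM ?posrE ?ltr0n ?fact_gt0//.
case: n IH => [_|n IH]; first by rewrite !ln1; lra.
have h := ln_natS_le R n.
have n0 : (0 : R) < n.+1%:R by [].
have : n.+1%:R * (ln (n.+2%:R : R) - ln n.+1%:R) <= 1.
  by rewrite -(ler_pdivlMl _ _ n0) mulr1.
by rewrite -[X in X * _ - _]natr1 -[X in _ - X <= _]natr1; nra.
Qed.

(** * Mertens' first theorem and a lower bound for Chebyshev's function *)

(** Legendre's formula bounds the exponent of [p] in [n!] by [n / (p - 1)]. *)
Lemma logn_fact_le (p n : nat) : prime p -> (logn p n`! * p.-1 <= n)%N.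
Proof.
move=> pp; rewrite logn_fact//.
set V := (\sum_(1 <= k < n.+1) n %/ p ^ k)%N.
have h : (V * p <= n + V)%N.
  rewrite /V big_distrl /=.
  have -> : (\sum_(1 <= i < n.+1) n %/ p ^ i * p =
             \sum_(0 <= i < n) n %/ p ^ i.+1 * p)%N by rewrite big_add1.
  apply: (@leq_trans (\sum_(0 <= i < n) n %/ p ^ i)%N).
    rewrite leq_sum// => i _.
    by rewrite expnSr divnMA leq_divM.
  apply: (@leq_trans (\sum_(0 <= i < n.+1) n %/ p ^ i)%N).
    by rewrite big_nat_recr //= leq_addr.
  by rewrite big_nat_recl// expn0 divn1 big_add1.
have p1 := prime_gt1 pp; case: p p1 pp @V h => // p p1 pp V h /=.
by rewrite mulnS in h; lia.
Qed.

Lemma logn_fact_ge (p n : nat) : prime p -> (n %/ p <= logn p n`!)%N.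
Proof.
move=> pp; rewrite logn_fact//.
case: n => [|n]; first by rewrite div0n.
by rewrite big_ltn// expn1 leq_addr.
Qed.

Lemma ln_prime_decomp (R : realType) (m N : nat) :
    (0 < m)%N -> (forall p, prime p -> (p %| m)%N -> (p <= N)%N) ->
  ln (m%:R : R) = \sum_(0 <= p < N.+1 | prime p) (logn p m)%:R * ln p%:R.
Proof.
move=> m0 hm.
have e : m = (\prod_(0 <= p < N.+1 | prime p) p ^ logn p m)%N.
  rewrite [LHS](prod_prime_decomp m0) prime_decompE big_map /=.
  rewrite -[in RHS]big_filter.
  rewrite [RHS](bigID (mem (primes m))) /= -[LHS]muln1; congr muln; last first.
    rewrite big1_seq// => p /andP[pm]; rewrite mem_filter => /andP[pp _].
    by move: pm; rewrite mem_primes pp m0 /= => pm; rewrite lognE pp m0 (negbTE pm).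
  rewrite -[RHS]big_filter; apply: perm_big; apply: uniq_perm.
  - exact: primes_uniq.
  - by rewrite !filter_uniq// iota_uniq.
  - move=> p; rewrite !mem_filter mem_primes m0 mem_iota add1n ltnS.
    case pp: (prime p); case pm: (p %| m)%N; rewrite ?andbF ?andbT//=.
    by rewrite prime_gt0// hm.
rewrite {1}e.
suff [] : (0 < \prod_(0 <= p < N.+1 | prime p) p ^ logn p m)%N /\
    ln ((\prod_(0 <= p < N.+1 | prime p) p ^ logn p m)%N%:R : R) =
    \sum_(0 <= p < N.+1 | prime p) (logn p m)%:R * ln p%:R by [].
elim/big_rec2: _ => [|p x y pp [y0 IH]]; first by rewrite ln1.
have p0 := prime_gt0 pp.
rewrite muln_gt0 expn_gt0 p0 y0; split => //.
rewrite natrM lnM ?posrE ?ltr0n ?expn_gt0 ?p0// natrX lnXn ?ltr0n//.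
by rewrite IH mulr_natl.
Qed.

(** Chebyshev's function, the sum of [ln p] over the primes [p <= n]. *)
Definition theta (R : realType) (n : nat) : R :=
  \sum_(0 <= p < n.+1 | prime p) ln p%:R.

(** The Mertens sum of [ln p / p] over the primes [p <= n]. *)
Definition mertens (R : realType) (n : nat) : R :=
  \sum_(0 <= p < n.+1 | prime p) ln p%:R / p%:R.

(** The logarithm of [n!] as a sum over primes. *)
Lemma ln_fact_decomp (R : realType) (n : nat) :
  ln (n`!%:R : R) = \sum_(0 <= p < n.+1 | prime p) (logn p n`!)%:R * ln p%:R.
Proof.
apply: ln_prime_decomp; first exact: fact_gt0.
move=> p pp; elim: n => [|n IH]; first by rewrite fact0 dvdn1; case: eqP pp => // ->.
rewrite factS Euclid_dvdM// => /orP[/dvdn_leq|/IH]; first exact.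
exact: leqW.
Qed.

Lemma mertens_le (R : realType) (n : nat) :
  (0 < n)%N -> mertens R n <= ln n%:R + theta R n / n%:R.
Proof.
move=> n0; have n0R : (0 : R) < n%:R by rewrite ltr0n.
rewrite -(ler_pM2l n0R) mulrDr mulrCA divff ?gt_eqF// mulr1.
rewrite -lerBlDr; apply: le_trans (ln_fact_le R n); rewrite ln_fact_decomp.
rewrite /mertens /theta mulr_sumr -sumrB ler_sum// => p pp.
have p0 : (0 : R) < p%:R by rewrite ltr0n prime_gt0.
rewrite mulrCA -[X in _ - X]mulr1 -mulrBr mulrC ler_wpM2r ?ln_nat_ge0//.
apply: (@le_trans _ _ (n %/ p)%:R); last by rewrite ler_nat logn_fact_ge.
rewrite lerBlDr natr1 ler_pdivrMr// -natrM ler_nat.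
by rewrite ltnW// ltn_ceil// prime_gt0.
Qed.

(** The terms [ln m / (m (m - 1))] telescope against [(ln m + 2) / m]. *)
Lemma ln_div_telescope (R : realType) (m : nat) :
  ln (m.+2%:R : R) / (m.+2%:R * m.+1%:R) <=
  (ln m.+1%:R + 2) / m.+1%:R - (ln m.+2%:R + 2) / m.+2%:R.
Proof.
have h := ln_natS_le R m.
set a := ln m.+1%:R in h *; set b := ln m.+2%:R in h *.
have m1 : (0 : R) < m.+1%:R by [].
have m2 : (0 : R) < m.+2%:R by [].
have -> : (a + 2) / m.+1%:R - (b + 2) / m.+2%:R =
   ((a + 2) * m.+2%:R - (b + 2) * m.+1%:R) / (m.+2%:R * m.+1%:R).
  by field; rewrite !gt_eqF.
rewrite ler_pM2r ?invr_gt0 ?mulr_gt0//.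
have e : (m.+2%:R : R) = m.+1%:R + 1 by rewrite natr1.
have h2 : m.+1%:R * (b - a) <= 1 by rewrite -(ler_pdivlMl _ _ m1) mulr1.
have h3 : (b - a) <= 1.
  by apply: le_trans h _; rewrite invf_le1// ler1n.
rewrite e; nra.
Qed.

Lemma mertens_ge (R : realType) (n : nat) :
  (0 < n)%N -> ln n%:R - 3 <= mertens R n.
Proof.
move=> n0; have n0R : (0 : R) < n%:R by rewrite ltr0n.
have h1 : ln n%:R - 1 <= \sum_(0 <= p < n.+1 | prime p) ln (p%:R : R) / p.-1%:R.
  rewrite -(ler_pM2l n0R) mulrBr mulr1.
  apply: le_trans (ln_fact_ge R n) _; rewrite ln_fact_decomp.
  rewrite mulr_sumr ler_sum// => p pp.
  have p0 : (0 : R) < p.-1%:R by rewrite ltr0n -subn1 subn_gt0 prime_gt1.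
  rewrite mulrC mulrCA ler_wpM2l ?ln_nat_ge0// ler_pdivlMr//.
  by rewrite -natrM ler_nat logn_fact_le.
have h2 : \sum_(0 <= p < n.+1 | prime p) (ln (p%:R : R) / p.-1%:R - ln p%:R / p%:R) <= 2.
  apply: (@le_trans _ _ (\sum_(2 <= m < n.+2) (ln (m%:R : R) / (m%:R * m.-1%:R)))).
    rewrite big_mkcond (@big_cat_nat _ _ _ 2)//=.
    rewrite [X in X + _]big1_seq ?add0r; last first.
      by move=> i; rewrite mem_index_iota; case: i => [|[|]].
    rewrite [X in _ <= X]big_nat_recr //=.
    apply: ler_wpDr; first by rewrite mulr_ge0 ?ln_nat_ge0// invr_ge0 -natrM.
    rewrite big_nat_cond [X in _ <= X]big_nat_cond ler_sum// => i /andP[/andP[i2 _] _].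
    case: i i2 => [|[|i]]// _; case: ifP => _; last first.
      by rewrite mulr_ge0 ?ln_nat_ge0// invr_ge0 -natrM.
    have e : (i.+2%:R : R) = i.+1%:R + 1 by rewrite natr1.
    rewrite le_eqVlt; apply/orP; left; apply/eqP.
    have i1 : (0 : R) < i.+1%:R by [].
    by rewrite /= e; field; apply/andP; split; lra.
  have h3 k : \sum_(2 <= m < k.+2) (ln (m%:R : R) / (m%:R * m.-1%:R)) <=
           2 - (ln k.+1%:R + 2) / k.+1%:R.
    elim: k => [|k IH]; first by rewrite big_geq// ln1; lra.
    rewrite big_nat_recr//=; apply: le_trans (lerD IH (ln_div_telescope R k)) _.
    by rewrite addrA subrK.
  apply: le_trans (h3 n) _; rewrite lerBlDr lerDl.
  by rewrite divr_ge0// addr_ge0// ln_nat_ge0.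
rewrite sumrB in h2; rewrite /mertens; lra.
Qed.

Lemma mertens_theta_rec (R : realType) (n : nat) :
  mertens R n.+1 - mertens R n = (theta R n.+1 - theta R n) / n.+1%:R.
Proof.
rewrite /mertens /theta big_mkcond [in X in _ - X]big_mkcond.
rewrite [in RHS]big_mkcond [in X in _ = (_ - X) / _]big_mkcond /=.
rewrite !(big_nat_recr n.+1)//= addrAC subrr add0r [in RHS]addrAC subrr add0r.
by case: ifP; rewrite ?mul0r.
Qed.

(** Partial summation: a bound [theta m <= c m] on [A, B] makes the Mertens sum
    grow at most like [c ln] there. *)
Lemma mertens_growth (R : realType) (c : R) (A B : nat) :
    0 <= c -> (0 < A)%N -> (A <= B)%N ->
    (forall m, (A <= m <= B)%N -> theta R m <= c * m%:R) ->
  mertens R B <= mertens R A + theta R B / B%:R - theta R A / A%:R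
                  + c * (ln B%:R - ln A%:R).
Proof.
move=> c0 A0; elim: B => [|B IH]; first by rewrite leqn0 => /eqP AE; rewrite AE in A0.
rewrite leq_eqVlt => /predU1P[<- _|]; first lra.
rewrite ltnS => AB h.
have {}IH := IH AB (fun m Am => h m ltac:(lia)).
have hB := h B ltac:(lia).
have e := mertens_theta_rec R B.
case: B AB h IH hB e => [|B] AB h IH hB e; first by lia.
have l := ln_natS_ge R B.
have b1 : (0 : R) < B.+1%:R by [].
have b2 : (0 : R) < B.+2%:R by [].
have k : theta R B.+1 / B.+1%:R - theta R B.+1 / B.+2%:R <= c * (ln B.+2%:R - ln B.+1%:R).
  apply: (@le_trans _ _ (c * B.+2%:R^-1)); last by rewrite ler_wpM2l.
  have -> : theta R B.+1 / B.+1%:R - theta R B.+1 / B.+2%:R =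
            theta R B.+1 * (B.+1%:R^-1 * B.+2%:R^-1).
    have e2 : (B.+2%:R : R) = B.+1%:R + 1 by rewrite natr1.
    by rewrite e2; field; apply/andP; split; lra.
  rewrite mulrA; apply: ler_wpM2r; first by rewrite invr_ge0.
  by rewrite ler_pdivrMr.
rewrite mulrBl in e.
move: IH e k; set x := theta R _ / _; set y := theta R _ / _; set z := theta R _ / _.
set u := theta R _ / _; move: x y z u => x y z u; lra.
Qed.

(** Otherwise [theta m < (1 - e) m] throughout [A, B], and the Mertens sum would
    grow there by at most [(1 - e) ln (B / A)] up to a constant, whereas it grows
    by [ln (B / A)] up to a constant. The upper bound for the Mertens sum at [A]
    also comes from [theta A <= A], so that no Chebyshev bound is needed. *)
Lemma theta_large (R : realType) (e : R) (A B : nat) :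
    0 < e < 1 -> (0 < A)%N -> (A <= B)%N -> 5 < e * (ln B%:R - ln A%:R) ->
  exists2 m, (A <= m <= B)%N & (1 - e) * m%:R <= theta R m.
Proof.
move=> /andP[e0 e1] A0 AB h5.
apply: contrapT => hn.
have h m : (A <= m <= B)%N -> theta R m <= (1 - e) * m%:R.
  move=> Am; apply: ltW; rewrite ltNge; apply/negP => hm; apply: hn.
  by exists m.
have e1' : 0 <= 1 - e by lra.
have g := mertens_growth R _ _ _ e1' A0 AB h.
have lA := mertens_le R _ A0.
have B0 : (0 < B)%N by lia.
have lB := mertens_ge R _ B0.
have tB : theta R B / B%:R <= 1 - e.
  by rewrite ler_pdivrMr ?ltr0n// h// AB leqnn.
nra.
Qed.

(** The number of primes in the interval ]a, b]. *)
Definition primes_in (a b : nat) : nat :=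
  count prime (index_iota a.+1 b.+1).

Lemma theta_le_count (R : realType) (n : nat) :
  theta R n <= (primes_in 0 n)%:R * ln n%:R.
Proof.
rewrite /theta /primes_in -sum1_count natr_sum mulr_suml.
rewrite big_ltn_cond//= big_nat_cond [X in _ <= X]big_nat_cond.
rewrite ler_sum// => p /andP[/andP[p0 pn] _].
by rewrite mul1r ln_nat_le.
Qed.

(** * Sums over subsets *)

Lemma sum_subset_prod (R : comNzRingType) (T : finType) (A : {set T}) (a : T -> R) :
  \prod_(i in A) (1 + a i) = \sum_(L : {set T} | L \subset A) \prod_(i in L) a i.
Proof.
rewrite big_mkcond /= (eq_bigr (fun i => (if i \in A then a i else 0) + 1)); last first.
  by move=> i _; case: ifP => _; rewrite ?add0r// addrC.
rewrite bigA_distr /= big_mkcond [RHS]big_mkcond /=; apply: eq_bigr => L _.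
case: ifPn => [/fintype.subsetP LA|/fintype.subsetPn[i iL iA]].
  rewrite [RHS]big_mkcond; apply: eq_bigr => i _.
  by case: ifP => // /LA ->.
by rewrite (bigD1 i)//= iL (negbTE iA) mul0r.
Qed.

(** Moebius inversion on the lattice of subsets. *)
Lemma sum_signs_interval (R : comNzRingType) (T : finType) (L M : {set T}) :
  L \subset M ->
  \sum_(I : {set T} | (L \subset I) && (I \subset M)) (-1) ^+ #|I| =
    if L == M then (-1) ^+ #|L| else 0 :> R.
Proof.
move=> LM; case: eqVneq => [<-|LneM].
  rewrite (big_pred1 L)// => I /=.
  by rewrite eq_sym finset.eqEsubset.
have [x xM xL] : exists2 x, x \in M & x \notin L.
  by apply/fintype.subsetPn; apply: contra LneM => ML; rewrite finset.eqEsubset LM.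
rewrite (bigID (fun I : {set T} => x \in I)) /=.
rewrite [X in _ + X](reindex_onto (fun I => I :\ x) (fun I => x |: I)) /=; last first.
  by move=> I /andP[_ xI]; rewrite finset.setU1K.
rewrite [X in _ + X](eq_bigl (fun I : {set T} => ((L \subset I) && (I \subset M)) && (x \in I))); last first.
  move=> I; rewrite !inE eqxx andbT.
  have [xI|xI] := boolP (x \in I); last first.
    rewrite andbF; apply/negbTE; rewrite negb_and; apply/orP; right.
    by apply: contraNneq xI => <-; rewrite finset.setU11.
  rewrite finset.setD1K// eqxx !andbT finset.subsetD1 xL andbT; congr andb.
  rewrite -[in RHS](finset.setD1K xI) finset.subUset finset.sub1set xM.
  by [].
rewrite -big_split /= big1// => I /andP[_ xI].
by rewrite (cardsD1 x I) xI exprS mulN1r addNr.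
Qed.

(** Exchanging the part of [M] inside [A] for an arbitrary subset [L] of [A] is
    injective in [(M, L)], and stays within a family closed under subsets. *)
Lemma sum_exchange_part_le (R : numDomainType) (T : finType) (F : pred {set T})
    (A : {set T}) (f : {set T} -> R) :
    (forall B C : {set T}, B \subset C -> F C -> F B) ->
    (forall B, 0 <= f B) ->
  \sum_(M | F M && (A \subset M)) \sum_(L : {set T} | L \subset A) f (L :|: (M :\: A))
    <= \sum_(M | F M) f M.
Proof.
move=> Fdown f0.
rewrite [X in _ <= X](bigID (fun M : {set T} => F (M :|: A))) /=.
apply: ler_wpDr; first by rewrite sumr_ge0.
rewrite [X in _ <= X](partition_big (fun M => M :|: A) (fun M => F M && (A \subset M))) /=; last first.
  by move=> M /andP[_ ->]; rewrite finset.subsetUr.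
apply: ler_sum => M /andP[FM AM].
rewrite [X in _ <= X](reindex_onto (fun L => L :|: (M :\: A)) (fun M' => M' :&: A)) /=; last first.
  move=> M' /andP[_ /eqP <-]; apply/finset.setP => x; rewrite !inE.
  by case: (x \in M'); case: (x \in A).
rewrite le_eqVlt; apply/orP; left; apply/eqP; apply: eq_bigl => L.
apply/idP/idP => [LA|/andP[_ /eqP <-]]; last exact: finset.subsetIr.
have e1 : L :|: M :\: A :|: A = M.
  apply/finset.setP => x; rewrite !inE; have := fintype.subsetP LA x; have := fintype.subsetP AM x.
  by case: (x \in L); case: (x \in A); case: (x \in M) => //= a b; rewrite ?b ?a.
have e2 : (L :|: M :\: A) :&: A = L.
  apply/finset.setP => x; rewrite !inE; have := fintype.subsetP LA x.
  by case: (x \in L); case: (x \in A); case: (x \in M) => //= a; rewrite ?a.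
rewrite e1 e2 !eqxx FM !andbT; apply: Fdown FM.
by rewrite -{2}e1 finset.subsetUl.
Qed.

(** The interval ]x, x + N] contains [N / d] multiples of [d], up to 1. *)
Lemma sum_dvdn_interval (R : realFieldType) (d x N : nat) : (0 < d)%N ->
  `|\sum_(x.+1 <= m < (x + N).+1) (d %| m)%N%:R - N%:R / d%:R| <= 1 :> R.
Proof.
move=> d0.
have e y : (\sum_(1 <= m < y.+1) (d %| m) = y %/ d)%N.
  by rewrite divn_count_dvd.
have e2 : \sum_(x.+1 <= m < (x + N).+1) ((d %| m)%N%:R : R) =
    ((x + N) %/ d)%N%:R - (x %/ d)%:R.
  rewrite -!e !natr_sum [X in _ = X - _](@big_cat_nat _ _ _ x.+1)//=.
    by rewrite addrAC subrr add0r.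
  by rewrite ltnS leq_addr.
rewrite e2.
have dR : (0 : R) < d%:R by rewrite ltr0n.
have a1 : ((x + N) %/ d)%N%:R <= (x%:R + N%:R) / d%:R :> R.
  by rewrite ler_pdivlMr// -natrM -natrD ler_nat leq_divM.
have a2 : (x%:R + N%:R) / d%:R < ((x + N) %/ d)%N%:R + 1 :> R.
  by rewrite ltr_pdivrMr// natr1 -natrM -natrD ltr_nat ltn_ceil.
have b1 : (x %/ d)%N%:R <= x%:R / d%:R :> R.
  by rewrite ler_pdivlMr// -natrM ler_nat leq_divM.
have b2 : x%:R / d%:R < (x %/ d)%N%:R + 1 :> R.
  by rewrite ltr_pdivrMr// natr1 -natrM ltr_nat ltn_ceil.
rewrite mulrDl in a1 a2.
by rewrite ler_norml; apply/andP; split; lra.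
Qed.

(** * Squarefree numbers as sets of primes *)

(** A squarefree number is represented by the set of its prime divisors,
    inside ['I_K.+1]; [sprod I] is the number itself. *)
Definition sprod {K : nat} (I : {set 'I_K.+1}) : nat := \prod_(p in I) (p : nat).

(** Only sets consisting of primes represent squarefree numbers. *)
Definition prime_set {K : nat} (I : {set 'I_K.+1}) : bool :=
  [forall p in I, prime (p : 'I_K.+1)].

Lemma prime_setP {K : nat} {I : {set 'I_K.+1}} :
  reflect (forall p : 'I_K.+1, p \in I -> prime p) (prime_set I).
Proof. exact: 'forall_implyP. Qed.

Lemma prime_setU {K : nat} {I J : {set 'I_K.+1}} :
  prime_set I -> prime_set J -> prime_set (I :|: J).
Proof.
move=> /prime_setP hI /prime_setP hJ; apply/prime_setP => p.
by rewrite inE => /orP[/hI|/hJ].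
Qed.

Lemma prime_setS {K : nat} {I J : {set 'I_K.+1}} :
  I \subset J -> prime_set J -> prime_set I.
Proof. by move=> /fintype.subsetP IJ /prime_setP h; apply/prime_setP => p /IJ /h. Qed.

Lemma sprod_gt0 {K : nat} {I : {set 'I_K.+1}} : prime_set I -> (0 < sprod I)%N.
Proof. by move=> /prime_setP h; apply: prodn_cond_gt0 => p /h /prime_gt0. Qed.

Lemma sprod_setUI {K : nat} {I J : {set 'I_K.+1}} :
  (sprod (I :|: J) * sprod (I :&: J) = sprod I * sprod J)%N.
Proof.
rewrite /sprod (big_setID I) /= [in RHS](big_setID I (A := J)) /=.
rewrite finset.setUK finset.setDUl finset.setDv finset.set0U finset.setIC.
rewrite -!mulnA; congr muln.
by rewrite mulnC.
Qed.

Lemma dvdn_sprod {K : nat} (m : nat) (I : {set 'I_K.+1}) : prime_set I ->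
  (sprod I %| m)%N = [forall p in I, (p : nat) %| m]%N.
Proof.
move=> /prime_setP pI; apply/idP/'forall_implyP => [Im p pp|h].
  by apply: dvdn_trans Im; rewrite /sprod (bigD1 p)//= dvdn_mulr.
suff : forall s : seq 'I_K.+1, uniq s -> {subset s <= I} ->
    (\prod_(p <- s) (p : nat) %| m)%N.
  by move/(_ (enum I)); rewrite enum_uniq big_enum; apply => // p; rewrite mem_enum.
elim=> [|p s IH] /=; first by rewrite big_nil dvd1n.
move=> /andP[ps us] sI; rewrite big_cons Gauss_dvd.
  rewrite h ?sI ?mem_head//=; apply: IH => // q qs.
  by rewrite sI// inE qs orbT.
rewrite prime_coprime ?pI ?sI ?mem_head//.
apply: contra ps; rewrite Euclid_dvd_prod ?pI ?sI ?mem_head// big_has.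
move=> /hasP[q qs]; rewrite dvdn_prime2 ?pI ?sI ?mem_head ?inE ?qs ?orbT//.
by move=> /eqP/val_inj ->.
Qed.

Lemma mem_sprod {K : nat} {I : {set 'I_K.+1}} (p : 'I_K.+1) :
  prime_set I -> prime p -> (p %| sprod I)%N -> p \in I.
Proof.
move=> /prime_setP pI pp.
rewrite /sprod -big_enum Euclid_dvd_prod// big_has => /hasP[q].
by rewrite mem_enum => qI; rewrite dvdn_prime2 ?(pI q)// => /eqP/val_inj ->.
Qed.

Lemma sprod_inj {K : nat} {I J : {set 'I_K.+1}} :
  prime_set I -> prime_set J -> sprod I = sprod J -> I = J.
Proof.
suff h (A B : {set 'I_K.+1}) :
    prime_set A -> prime_set B -> sprod A = sprod B -> A \subset B.
  by move=> pI pJ e; apply/eqP; rewrite finset.eqEsubset !h.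
move=> pA pB e; apply/fintype.subsetP => p pinA.
apply: mem_sprod => //; first by move/prime_setP : pA; apply.
by rewrite -e /sprod (bigD1 p)//= dvdn_mulr.
Qed.

(** * Selberg's upper bound sieve *)

(** The squarefree numbers up to the level [K] of the sieve. *)
Definition sieve_family {K : nat} (I : {set 'I_K.+1}) : bool :=
  prime_set I && (sprod I <= K)%N.

(** The reciprocal of Euler's totient of [sprod I]. *)
Definition sieve_weight (R : realFieldType) {K : nat} (I : {set 'I_K.+1}) : R :=
  \prod_(p in I) (p.-1%:R)^-1.

(** Selberg's main term: the sum of [1 / phi d] over squarefree [d <= K]. *)
Definition sieve_mass (R : realFieldType) (K : nat) : R :=
  \sum_(I : {set 'I_K.+1} | sieve_family I) sieve_weight R I.

(** The part of [sieve_mass] carried by the multiples of [sprod I]. *)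
Definition sieve_tail (R : realFieldType) {K : nat} (I : {set 'I_K.+1}) : R :=
  \sum_(M : {set 'I_K.+1} | sieve_family M && (I \subset M)) sieve_weight R M.

(** Selberg's optimal coefficients
    [lambda d = mu d * d * (sum of 1 / phi m over multiples m of d) / mass]. *)
Definition selberg (R : realFieldType) {K : nat} (I : {set 'I_K.+1}) : R :=
  (-1) ^+ #|I| * (sprod I)%:R * sieve_tail R I / sieve_mass R K.

Lemma sieve_familyS {K : nat} {I J : {set 'I_K.+1}} :
  I \subset J -> sieve_family J -> sieve_family I.
Proof.
move=> IJ /andP[pJ JK]; rewrite /sieve_family (prime_setS IJ pJ)/=.
apply: leq_trans JK; rewrite dvdn_leq ?sprod_gt0//.
rewrite /sprod [X in (_ %| X)%N](big_setID I) /= (finset.setIidPr IJ).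
exact: dvdn_mulr.
Qed.

Lemma sieve_weight_ge0 (R : realFieldType) {K : nat} (I : {set 'I_K.+1}) :
  0 <= sieve_weight R I.
Proof. by apply: prodr_ge0 => p _; rewrite invr_ge0. Qed.

Lemma sieve_family0 (K : nat) : (0 < K)%N -> sieve_family (finset.set0 : {set 'I_K.+1}).
Proof.
move=> K0; rewrite /sieve_family /sprod big_set0 K0 andbT.
by apply/prime_setP => p; rewrite inE.
Qed.

Lemma sieve_mass_ge1 (R : realFieldType) (K : nat) : (0 < K)%N -> 1 <= sieve_mass R K.
Proof.
move=> K0; rewrite /sieve_mass (bigD1 finset.set0) ?sieve_family0//=.
rewrite {1}/sieve_weight big_set0 lerDl sumr_ge0// => I _.
exact: sieve_weight_ge0.
Qed.

Lemma sieve_weight_split (R : realFieldType) {K : nat} {L A : {set 'I_K.+1}} :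
  L :&: A = finset.set0 ->
  sieve_weight R (L :|: A) = sieve_weight R L * sieve_weight R A.
Proof.
move=> LA; rewrite /sieve_weight (big_setID L) /= finset.setUK.
congr (_ * _); apply: eq_bigl => p; rewrite !inE.
by have := congr1 (fun B : {set _} => p \in B) LA; rewrite !inE; case: (p \in L) => //= ->.
Qed.

Lemma sprod_sieve_weight (R : realFieldType) {K : nat} {I : {set 'I_K.+1}} :
  prime_set I ->
  (sprod I)%:R * sieve_weight R I =
    \sum_(L : {set 'I_K.+1} | L \subset I) sieve_weight R L.
Proof.
move=> /prime_setP pI; rewrite -sum_subset_prod /sprod natr_prod -big_split /=.
apply: eq_bigr => p /pI pp.
have p0 : (0 : R) < p.-1%:R by rewrite ltr0n -subn1 subn_gt0 prime_gt1.
rewrite -[in X in X * _](prednK (prime_gt0 pp)) -natr1 mulrDl mul1r divff//.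
by rewrite gt_eqF.
Qed.

(** Since [d / phi d] is the sum of [1 / phi l] over [l] dividing [d], the
    product [d * sieve_tail d] expands into distinct terms of the mass. *)
Lemma selberg_le1 (R : realFieldType) {K : nat} {I : {set 'I_K.+1}} :
  (0 < K)%N -> sieve_family I -> `|selberg R I| <= 1.
Proof.
move=> K0 /[dup] fI /andP[pI _].
have m0 : 0 < sieve_mass R K by apply: lt_le_trans (sieve_mass_ge1 R _ K0).
rewrite /selberg 3!normrM normrX normrN1 expr1n mul1r normr_nat.
rewrite (ger0_norm (x := sieve_tail R I)); last first.
  by rewrite sumr_ge0// => M _; apply: sieve_weight_ge0.
rewrite ger0_norm ?invr_ge0 ?(ltW m0)// ler_pdivrMr// mul1r.
have h := @sum_exchange_part_le R _ sieve_family I _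
  (fun B C => @sieve_familyS K B C) (sieve_weight_ge0 R).
apply: le_trans h; rewrite /sieve_tail mulr_sumr.
apply: ler_sum => M /andP[fM IM].
rewrite -[in X in X <= _](finset.setID M I) (finset.setIidPr IM).
rewrite sieve_weight_split; last first.
  by apply/finset.setP => x; rewrite !inE; case: (x \in I).
rewrite mulrA sprod_sieve_weight// mulr_suml.
apply: ler_sum => L LI; rewrite sieve_weight_split//.
apply/finset.setP => x; rewrite !inE.
by have := fintype.subsetP LI x; case: (x \in L) => //= ->.
Qed.

Lemma selberg0 (R : realFieldType) (K : nat) : (0 < K)%N ->
  selberg R (finset.set0 : {set 'I_K.+1}) = 1.
Proof.
move=> K0; have m0 : 0 < sieve_mass R K by apply: lt_le_trans (sieve_mass_ge1 R _ K0).
rewrite /selberg cards0 expr0 /sprod big_set0 !mul1r.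
rewrite (_ : sieve_tail R _ = sieve_mass R K) ?divff ?gt_eqF//.
by apply: eq_bigl => M; rewrite finset.sub0set andbT.
Qed.

(** The change of variables diagonalising the quadratic form of the sieve. *)
Lemma selberg_inversion (R : realFieldType) {K : nat} (L : {set 'I_K.+1}) :
    sieve_family L ->
  \sum_(I : {set 'I_K.+1} | sieve_family I && (L \subset I))
      selberg R I / (sprod I)%:R =
    (-1) ^+ #|L| * sieve_weight R L / sieve_mass R K.
Proof.
move=> fL.
rewrite (eq_bigr (fun I : {set 'I_K.+1} => \sum_(M | sieve_family M && (I \subset M))
   ((-1) ^+ #|I| * (sieve_weight R M / sieve_mass R K)))); last first.
  move=> I /andP[/andP[pI _] _]; rewrite -mulr_sumr -mulr_suml -/(sieve_tail R I).
  rewrite /selberg; have s0 : (sprod I)%:R != 0 :> R by rewrite pnatr_eq0 -lt0n sprod_gt0.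
  by move: (sieve_mass R K)^-1 => m; field.
rewrite (exchange_big_dep (fun M : {set 'I_K.+1} => sieve_family M && (L \subset M))) /=; last first.
  by move=> I M /andP[_ LI] /andP[-> IM]; rewrite (fintype.subset_trans LI IM).
rewrite (eq_bigr (fun M : {set 'I_K.+1} =>
   (if L == M then (-1) ^+ #|L| else 0) * (sieve_weight R M / sieve_mass R K))); last first.
  move=> M /andP[fM LM]; rewrite -mulr_suml -(sum_signs_interval R _ L M LM); congr (_ * _).
  apply: eq_bigl => I; rewrite fM /=.
  case IM: (I \subset M); rewrite ?andbF// !andbT.
  by rewrite (sieve_familyS IM fM).
rewrite (bigD1 L) ?fL ?fintype.subxx//= eqxx big1 ?addr0 ?mulrA// => M /andP[_ /negbTE].
by rewrite eq_sym => ->; rewrite mul0r.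
Qed.

(** The value of the quadratic form of the sieve, with [1 / lcm (d, e)] written
    as [gcd (d, e) / (d e)] and the gcd as the sum of [phi l] over its divisors
    [l]. *)
Lemma selberg_form (R : realFieldType) (K : nat) : (0 < K)%N ->
  \sum_(I : {set 'I_K.+1} | sieve_family I) \sum_(J : {set 'I_K.+1} | sieve_family J)
     selberg R I * selberg R J / (sprod (I :|: J))%:R = (sieve_mass R K)^-1.
Proof.
move=> K0; have m0 : 0 < sieve_mass R K by apply: lt_le_trans (sieve_mass_ge1 R _ K0).
pose phi (L : {set 'I_K.+1}) : R := \prod_(p in L) (p.-1%:R).
pose a (I : {set 'I_K.+1}) : R := selberg R I / (sprod I)%:R.
have h1 (I J : {set 'I_K.+1}) : sieve_family I -> sieve_family J ->
   selberg R I * selberg R J / (sprod (I :|: J))%:R =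
   \sum_(L : {set 'I_K.+1} | (L \subset I) && (L \subset J)) phi L * (a I * a J).
  move=> /andP[pI _] /andP[pJ _].
  have pIJ : prime_set (I :&: J) by apply: prime_setS pI; apply: finset.subsetIl.
  transitivity ((sprod (I :&: J))%:R * (a I * a J)).
    have e : (sprod (I :|: J))%:R * (sprod (I :&: J))%:R = (sprod I)%:R * (sprod J)%:R :> R.
      by rewrite -!natrM sprod_setUI.
    have u0 : (sprod (I :|: J))%:R != 0 :> R.
      by rewrite pnatr_eq0 -lt0n sprod_gt0// prime_setU.
    have i0 : (sprod I)%:R != 0 :> R by rewrite pnatr_eq0 -lt0n sprod_gt0.
    have j0 : (sprod J)%:R != 0 :> R by rewrite pnatr_eq0 -lt0n sprod_gt0.
    have n0 : (sprod (I :&: J))%:R != 0 :> R by rewrite pnatr_eq0 -lt0n sprod_gt0.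
    apply: (mulfI u0); rewrite [RHS]mulrA e /a [LHS]mulrC mulfVK//.
    by field; rewrite i0 j0.
  rewrite -mulr_suml; congr (_ * _).
  transitivity (\prod_(p in I :&: J) (1 + (p.-1%:R : R))).
    rewrite /sprod natr_prod; apply: eq_bigr => p pin.
    have pp : prime p by move/prime_setP : pIJ; apply.
    by rewrite -[in LHS](prednK (prime_gt0 pp)) -natr1 addrC.
  by rewrite sum_subset_prod; apply: eq_bigl => L; rewrite finset.subsetI.
transitivity (\sum_(I : {set 'I_K.+1} | sieve_family I) \sum_(J : {set 'I_K.+1} | sieve_family J)
    \sum_(L : {set 'I_K.+1} | (L \subset I) && (L \subset J)) phi L * (a I * a J)).
  by apply: eq_bigr => I fI; apply: eq_bigr => J fJ; exact: h1.
transitivity (\sum_(L : {set 'I_K.+1} | sieve_family L)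
    phi L * ((\sum_(I : {set 'I_K.+1} | sieve_family I && (L \subset I)) a I) *
             (\sum_(I : {set 'I_K.+1} | sieve_family I && (L \subset I)) a I))).
  under [RHS]eq_bigr do rewrite big_distrlr /= mulr_sumr.
  rewrite [RHS](exchange_big_dep sieve_family) /=; last by move=> L I _ /andP[].
  apply: eq_bigr => I fI.
  under [RHS]eq_bigr do rewrite mulr_sumr.
  rewrite [RHS](exchange_big_dep sieve_family) /=; last by move=> L J _ /andP[].
  apply: eq_bigr => J fJ; apply: eq_bigl => L; rewrite fI fJ /=.
  by case LI: (L \subset I); rewrite ?andbF//= (sieve_familyS LI fI).
transitivity (\sum_(L : {set 'I_K.+1} | sieve_family L)
    sieve_weight R L / sieve_mass R K ^+ 2).
  apply: eq_bigr => L fL; rewrite selberg_inversion//.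
  have pw : phi L * sieve_weight R L = 1.
    rewrite /phi /sieve_weight -big_split /= big1// => p pL.
    move: fL => /andP[/prime_setP /(_ _ pL) pp _].
    by rewrite divff// pnatr_eq0 -lt0n -subn1 subn_gt0 prime_gt1.
  have sg : ((-1) ^+ #|L| : R) * (-1) ^+ #|L| = 1 by rewrite -exprD addnn -signr_odd odd_double.
  transitivity (((-1) ^+ #|L| * (-1) ^+ #|L|) * (phi L * sieve_weight R L) *
     sieve_weight R L / sieve_mass R K ^+ 2).
    by field; rewrite gt_eqF.
  by rewrite sg pw !mul1r.
by rewrite -mulr_suml -/(sieve_mass R K) expr2 invfM mulrA divff ?gt_eqF// mul1r.
Qed.

Lemma card_sieve_family (K : nat) :
  (#|[set I : {set 'I_K.+1} | sieve_family I]%SET| <= K.+1)%N.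
Proof.
rewrite -[X in (_ <= X)%N]card_ord.
have inj : {in [set I : {set 'I_K.+1} | sieve_family I]%SET &,
    injective (fun I => inord (sprod I) : 'I_K.+1)}.
  move=> I J; rewrite !inE => /andP[pI IK] /andP[pJ JK] /(congr1 val) /=.
  by rewrite !inordK// => /sprod_inj; apply.
by rewrite -(card_in_imset inj) max_card.
Qed.

(** No prime up to [K] divides [m]. *)
Definition rough (K m : nat) : bool :=
  [forall p : 'I_K.+1, prime p ==> ~~ (p %| m)%N].

(** In any interval of length [N], few integers have no prime factor up to [K]:
    the indicator of those integers is at most the square of
    [sum of lambda d over d dividing m], because only [d = 1] divides a rough
    [m]. *)
Lemma selberg_sieve (R : realFieldType) (K x N : nat) : (0 < K)%N ->
  \sum_(x.+1 <= m < (x + N).+1) (rough K m)%:R <=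
    N%:R / sieve_mass R K + K.+1%:R ^+ 2.
Proof.
move=> K0.
pose ind (I : {set 'I_K.+1}) (m : nat) : R := (sprod I %| m)%N%:R.
have h1 m : (rough K m)%:R <=
    (\sum_(I : {set 'I_K.+1} | sieve_family I) selberg R I * ind I m) ^+ 2.
  case: (boolP (rough K m)) => [/forallP rm|_]; last exact: sqr_ge0.
  rewrite (bigD1 finset.set0) ?sieve_family0//= big1 ?addr0.
    by rewrite selberg0// /ind /sprod big_set0 dvd1n mulr1 expr1n.
  move=> I /andP[/andP[pI _] /set0Pn[p pin]].
  rewrite /ind dvdn_sprod//; case: (boolP [forall p in I, _]) => [|_]; last by rewrite mulr0.
  move=> /'forall_implyP/(_ p pin) pm; have := rm p.
  by move/prime_setP : pI => -> //; rewrite pm.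
apply: (le_trans (ler_sum _ (fun m _ => h1 m))).
have h2 : \sum_(x.+1 <= m < (x + N).+1)
      (\sum_(I : {set 'I_K.+1} | sieve_family I) selberg R I * ind I m) ^+ 2 =
    \sum_(I : {set 'I_K.+1} | sieve_family I) \sum_(J : {set 'I_K.+1} | sieve_family J)
      selberg R I * selberg R J *
        \sum_(x.+1 <= m < (x + N).+1) (sprod (I :|: J) %| m)%N%:R.
  under eq_bigr do rewrite expr2 big_distrlr /=.
  rewrite exchange_big /=; apply: eq_bigr => I /andP[pI _].
  rewrite exchange_big /=; apply: eq_bigr => J /andP[pJ _].
  rewrite mulr_sumr; apply: eq_bigr => m _.
  rewrite mulrACA; congr (_ * _); rewrite /ind -natrM mulnb; congr (_%:R).
  rewrite !dvdn_sprod ?prime_setU//; congr nat_of_bool.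
  apply/andP/'forall_implyP => [[/'forall_implyP hI /'forall_implyP hJ] p|h].
    by rewrite inE => /orP[/hI|/hJ].
  by split; apply/'forall_implyP => p pp; apply: h; rewrite inE pp ?orbT.
rewrite h2.
have h3 (I J : {set 'I_K.+1}) : sieve_family I -> sieve_family J ->
   selberg R I * selberg R J * \sum_(x.+1 <= m < (x + N).+1) (sprod (I :|: J) %| m)%N%:R
     <= N%:R * (selberg R I * selberg R J / (sprod (I :|: J))%:R) + 1.
  move=> fI fJ; have /andP[pI _] := fI; have /andP[pJ _] := fJ.
  have hd := sum_dvdn_interval R _ x N (sprod_gt0 (prime_setU pI pJ)).
  rewrite -lerBlDl [N%:R * _]mulrCA -mulrBr.
  apply: le_trans (ler_norm _) _; rewrite normrM (normrM (selberg R I)).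
  have l1 := selberg_le1 R K0 fI; have l2 := selberg_le1 R K0 fJ.
  by apply: mulr_ile1; rewrite ?mulr_ge0 ?mulr_ile1.
apply: (@le_trans _ _ (\sum_(I : {set 'I_K.+1} | sieve_family I) \sum_(J : {set 'I_K.+1} | sieve_family J)
   (N%:R * (selberg R I * selberg R J / (sprod (I :|: J))%:R) + 1))).
  by apply: ler_sum => I fI; apply: ler_sum => J fJ; exact: h3.
have cf : \sum_(I : {set 'I_K.+1} | sieve_family I) (1 : R) <= K.+1%:R.
  apply: (@le_trans _ _ #|[set I : {set 'I_K.+1} | sieve_family I]%SET|%:R).
    by rewrite -sum1dep_card natr_sum.
  by rewrite ler_nat card_sieve_family.
under eq_bigr do rewrite big_split /= -mulr_sumr.
rewrite big_split /= -mulr_sumr selberg_form// lerD2l.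
have -> : \sum_(I : {set 'I_K.+1} | sieve_family I) \sum_(J : {set 'I_K.+1} | sieve_family J) (1 : R)
   = (\sum_(I : {set 'I_K.+1} | sieve_family I) 1) ^+ 2.
  by rewrite expr2 big_distrlr /=; apply: eq_bigr => I _; apply: eq_bigr => J _; rewrite mulr1.
by rewrite lerXn2r ?nnegrE// sumr_ge0.
Qed.

(** * The mass of the sieve dominates the harmonic sum *)

(** The prime divisors of [k] that are at most [K]. *)
Definition psupp (K k : nat) : {set 'I_K.+1} :=
  [set p : 'I_K.+1 | prime p && (p %| k)%N]%SET.

Lemma prime_set_psupp (K k : nat) : prime_set (psupp K k).
Proof. by apply/prime_setP => p; rewrite inE => /andP[]. Qed.

Lemma sieve_family_psupp (K k : nat) : (0 < k <= K)%N -> sieve_family (psupp K k).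
Proof.
move=> /andP[k0 kK]; rewrite /sieve_family prime_set_psupp /=.
apply: leq_trans kK; apply: dvdn_leq => //; rewrite dvdn_sprod ?prime_set_psupp//.
by apply/'forall_implyP => p; rewrite inE => /andP[].
Qed.

(** The multiples of [p] up to [x] are the [p * j] with [j <= x / p]. *)
Lemma big_multiples (R : nmodType) (p x : nat) (f : nat -> R) : (0 < p)%N ->
  \sum_(1 <= k < x.+1 | (p %| k)%N) f k = \sum_(1 <= j < (x %/ p).+1) f (p * j)%N.
Proof.
move=> p0; elim: x => [|x IH]; first by rewrite div0n !big_geq.
rewrite big_mkcond big_nat_recr//= -big_mkcond IH divnS//.
case: (boolP (p %| x.+1)%N) => [px|_]; last by rewrite addr0 add0n.
rewrite add1n [RHS]big_nat_recr//=; congr (_ + f _).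
by have := divnK px; rewrite divnS// px add1n mulnC.
Qed.

(** The integers whose prime divisors are exactly those of [sprod I] contribute
    at most [prod_p 1 / (p - 1)] to the harmonic sum: divide out one prime. *)
Lemma sum_inv_psupp_le (R : realFieldType) (K x : nat) (I : {set 'I_K.+1}) :
    (x <= K)%N -> prime_set I ->
  \sum_(1 <= k < x.+1 | psupp K k == I) (k%:R)^-1 <= sieve_weight R I.
Proof.
elim/ltn_ind: x I => x IH I xK pI.
case: (posnP x) => [->|x0]; first by rewrite big_geq// sieve_weight_ge0.
have [->|[p pin]] := finset.set_0Vmem I.
  rewrite /sieve_weight big_set0 big_ltn_cond//= big1_seq; last first.
    move=> k /andP[/eqP k0]; rewrite mem_index_iota => /andP[k2 kx].
    have dk : (pdiv k < K.+1)%N.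
      by rewrite ltnS (leq_trans _ xK)// (leq_trans (pdiv_leq _))// ltnW.
    have := finset.in_set0 (Ordinal dk).
    by rewrite -k0 inE /= pdiv_prime// pdiv_dvd.
  by case: ifP => _; rewrite ?addr0 ?invr1 ?ler01.
have pp : prime p by move/prime_setP : pI; apply.
have p0 := prime_gt0 pp.
have xp : (x %/ p < x)%N by rewrite ltn_Pdiv// prime_gt1.
have pI' : prime_set (I :\ p) by apply: prime_setS pI; rewrite finset.subD1set.
have e1 := IH _ xp _ (leq_trans (ltnW xp) xK) pI.
have e2 := IH _ xp _ (leq_trans (ltnW xp) xK) pI'.
have w2 : sieve_weight R (I :\ p) = p.-1%:R * sieve_weight R I.
  rewrite [in RHS]/sieve_weight (big_setD1 p)//= mulrA divff ?mul1r//.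
  by rewrite pnatr_eq0 -lt0n -subn1 subn_gt0 prime_gt1.
have p0R : (0 : R) < p%:R by rewrite ltr0n.
apply: (@le_trans _ _ (p%:R^-1 * (sieve_weight R I + sieve_weight R (I :\ p)))); last first.
  rewrite w2 -[X in _ * (X + _)]mul1r -mulrDl nat1r prednK// mulrA mulVf ?mul1r//.
  by rewrite gt_eqF.
apply: le_trans (ler_wpM2l _ (lerD e1 e2)); last by rewrite invr_ge0 ltW.
rewrite (eq_bigl (fun k => (p %| k)%N && (psupp K k == I))); last first.
  move=> k; case: eqP => [e|]; rewrite ?andbF// andbT.
  by move: pin; rewrite -e inE => /andP[_ ->].
rewrite big_mkcondr /= big_multiples//.
rewrite [X in _ * (X + _)]big_mkcond [X in _ * (_ + X)]big_mkcond /= -big_split /= mulr_sumr.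
rewrite big_nat_cond [X in _ <= X]big_nat_cond.
apply: ler_sum => j /andP[/andP[j1 _] _].
have jR : (0 : R) < j%:R by rewrite ltr0n.
have nn (b : bool) : 0 <= (if b then j%:R^-1 else 0 : R).
  by case: b => //; rewrite invr_ge0 ltW.
case: eqP => [e|_]; last by rewrite mulr_ge0 ?invr_ge0 ?(ltW p0R)// addr_ge0.
rewrite natrM invfM ler_wpM2l ?invr_ge0 ?(ltW p0R)//.
have es : p |: psupp K j = I.
  rewrite -e; apply/finset.setP => q; rewrite !inE.
  case: eqVneq => [->|qp] /=; first by rewrite pp dvdn_mulr.
  case qq: (prime q) => //=; rewrite Euclid_dvdM// (dvdn_prime2 qq pp).
  by have -> : ((q : nat) == p) = false by exact: negbTE qp.
case: (boolP (p \in psupp K j)) => pj.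
  have -> : psupp K j == I by rewrite -es finset.setUC; apply/eqP/esym/finset.setUidPl; rewrite finset.sub1set.
  by rewrite lerDl.
have -> : psupp K j == I :\ p by rewrite -es finset.setU1K.
by rewrite lerDr.
Qed.

Lemma harmonic_le_mass (R : realFieldType) (K : nat) :
  \sum_(1 <= k < K.+1) (k%:R)^-1 <= sieve_mass R K.
Proof.
rewrite big_nat_cond.
rewrite (partition_big (psupp K) (@sieve_family K)) /=; last first.
  by move=> k /andP[kK _]; apply: sieve_family_psupp.
apply: ler_sum => I /andP[pI _].
apply: le_trans (sum_inv_psupp_le R K K I (leqnn K) pI).
rewrite [X in _ <= X]big_nat_cond le_eqVlt; apply/orP; left; apply/eqP.
by apply: eq_bigl => k; rewrite andbT.
Qed.

Lemma ln_le_mass (R : realType) (K : nat) : ln K.+1%:R <= sieve_mass R K.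
Proof.
apply: le_trans (harmonic_le_mass R K).
elim: K => [|K IH]; first by rewrite big_geq// ln1.
rewrite big_nat_recr//=; apply: le_trans (lerD IH (ln_natS_le R K)).
by rewrite addrC subrK.
Qed.

(** * Survivor sets *)

Lemma val_natr_Zp (i m : nat) : ((m%:R : 'Z_i.+2) : nat) = (m %% i.+2)%N.
Proof. exact: val_Zp_nat. Qed.

(** Membership in a survivor set in terms of residues of natural numbers. *)
Lemma mem_survivor (n : nat) (r : profile n) (m : 'I_n.+2) :
  reflect ((2 <= m)%N /\
           forall i : 'I_n.-1, (i.+2 < m)%N -> (m %% i.+2)%N <> r i :> nat)
          (m \in survivor r).
Proof.
rewrite inE; apply: (iffP andP) => -[m2].
  move=> /forallP h; split => // i im e; have := h i; rewrite im /=.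
  by move/eqP; apply; apply: val_inj; rewrite /= val_natr_Zp.
move=> h; split => //; apply/forallP => i; apply/implyP => im.
by apply/eqP => e; apply: (h i im); rewrite -e val_natr_Zp.
Qed.

(** The profile whose residue modulo [k] is that of [rho k]. *)
Definition profile_of (n : nat) (rho : nat -> nat) : profile n :=
  finfun (fun i : 'I_n.-1 => (rho i.+2)%:R : 'Z_i.+2).

Lemma profile_ofE (n : nat) (rho : nat -> nat) (i : 'I_n.-1) :
  (profile_of n rho i : nat) = (rho i.+2 %% i.+2)%N.
Proof. by rewrite ffunE val_natr_Zp. Qed.

(** * Upper bound for the number of survivor sets *)

Lemma chinese_seq (rho : nat -> nat) (s : seq nat) :
    uniq s -> all prime s ->
  exists c, forall p, p \in s -> (c = rho p %[mod p])%N.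
Proof.
elim: s => [|p s IH] /=; first by exists 0%N.
move=> /andP[ps us] /andP[pp als]; have [c hc] := IH us als.
have co : coprime p (\prod_(q <- s) q).
  rewrite prime_coprime// Euclid_dvd_prod// big_has; apply: contra ps => /hasP[q qs].
  by rewrite dvdn_prime2//; [move/eqP => -> | exact: (allP als)].
exists (chinese p (\prod_(q <- s) q) (rho p) c) => q; rewrite inE => /predU1P[->|qs].
  by rewrite chinese_modl.
have dq : (q %| \prod_(q <- s) q)%N by rewrite (big_rem q)//= dvdn_mulr.
have e := chinese_modr co (rho p) c.
by rewrite -(hc _ qs) -(modn_dvdm _ dq) e modn_dvdm.
Qed.

(** The residues modulo the primes [p <= K] are those of a single translate. *)
Lemma chinese_primes (rho : nat -> nat) (K : nat) :
  exists2 c, (c < K`!)%N & forall p, prime p -> (p <= K)%N -> (c = rho p %[mod p])%N.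
Proof.
have [c hc] := @chinese_seq rho [seq p <- iota 0 K.+1 | prime p]
  (filter_uniq _ (iota_uniq _ _)) (filter_all _ _).
exists (c %% K`!)%N; first by rewrite ltn_mod fact_gt0.
move=> p pp pK; rewrite modn_dvdm; first by apply: hc; rewrite mem_filter pp mem_iota.
by apply: dvdn_fact; rewrite prime_gt0.
Qed.

Lemma card_bigcup_le (T J : finType) (F : J -> {set T}) :
  (#|\bigcup_j F j| <= \sum_j #|F j|)%N.
Proof.
elim/big_rec2: _ => [|j y1 y2 _ IH]; first by rewrite cards0.
by apply: leq_trans (leq_card_setU _ _) _; rewrite leq_add2l.
Qed.

(** The numbers [m <= K], and the [m > 0] such that no prime up to [K] divides
    [c + m]. *)
Definition rough_cover (n K c : nat) : {set 'I_n.+2} :=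
  [set m : 'I_n.+2 | (m <= K)%N] :|: [set m : 'I_n.+2 | (0 < m)%N && rough K (c + m)].

(** Survivors above [K] avoid the residues modulo all primes up to [K], and by
    the Chinese remainder theorem these residues are [- c] for one number [c]. *)
Lemma survivor_sub_rough_cover (n K : nat) (r : profile n) :
  exists2 c, (c < K`!)%N & survivor r \subset rough_cover n K c.
Proof.
(* [- r_k] modulo [k], for [k = i + 2] *)
pose rho k := (if insub (k - 2)%N is Some i then k - r (i : 'I_n.-1) else 0)%N.
have [c cK hc] := chinese_primes rho K; exists c => //.
apply/fintype.subsetP => m /mem_survivor[m2 h]; rewrite !inE.
case: (leqP m K) => [//|Km] /=; rewrite (ltnW m2) /=.
apply/forallP => p; apply/implyP => pp; apply/negP => pm.
have pK : (p <= K)%N by rewrite -ltnS.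
have p2 := prime_gt1 pp.
have pn : (p - 2 < n.-1)%N by have := ltn_ord m; lia.
have := hc _ pp pK; rewrite /rho insubT /= => e.
have e2 : (Ordinal pn).+2 = p by rewrite /=; lia.
have rl : (r (Ordinal pn) < (Ordinal pn).+2)%N by exact: ltn_ord.
move: (h (Ordinal pn)) rl e; move: (nat_of_ord (r (Ordinal pn))) => a.
rewrite e2 => ha rl e; apply: ha; first exact: leq_ltn_trans Km.
have : (c + m = 0 %[mod p])%N by rewrite mod0n; apply/eqP.
rewrite -modnDml e modnDml => e3.
have : (m + p = a %[mod p])%N.
  have -> : (m + p = (p - a + m) + a)%N by rewrite addnAC subnK ?(ltnW rl)// addnC.
  by rewrite -modnDml e3 mod0n add0n.
by rewrite modnDr (modn_small rl).
Qed.

Lemma card_rough_cover_le (n K c b : nat) :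
    (\sum_(c.+1 <= m < (c + n.+1).+1) rough K m <= b)%N ->
  (#|rough_cover n K c| <= K.+1 + b)%N.
Proof.
move=> rough_le.
apply: leq_trans (leq_card_setU _ _) _; apply: leq_add.
  have inj : {in [set m : 'I_n.+2 | (m <= K)%N] &, injective (fun m : 'I_n.+2 => inord m : 'I_K.+1)}.
    move=> x y; rewrite !inE => xK yK /(congr1 val) /=; rewrite !inordK// => e.
    exact: val_inj.
  by rewrite -(card_in_imset inj) -[X in (_ <= X)%N]card_ord max_card.
apply: leq_trans rough_le; rewrite -sum1dep_card big_mkcond /=.
rewrite -(big_mkord xpredT (fun m => if (0 < m)%N && rough K (c + m) then 1 else 0)%N).
rewrite big_ltn//= add0n -[c.+1]add1n big_addn.
have -> : ((c + n.+1).+1 - c = n.+2)%N by lia.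
rewrite big_nat_cond [X in (_ <= X)%N]big_nat_cond leq_sum// => m /andP[/andP[m1 _] _].
by rewrite m1 /= addnC; case: rough.
Qed.

Lemma num_survivor_sets_le (n K b : nat) :
    (forall c, \sum_(c.+1 <= m < (c + n.+1).+1) rough K m <= b)%N ->
  (num_survivor_sets n <= K`! * 2 ^ (K.+1 + b))%N.
Proof.
move=> rough_le.
have sub : survivor_sets n \subset \bigcup_(c : 'I_(K`!)) powerset (rough_cover n K c).
  apply/fintype.subsetP => S /imsetP[r _ ->].
  have [c cK sU] := survivor_sub_rough_cover n K r.
  by apply/bigcupP; exists (Ordinal cK) => //; rewrite powersetE.
apply: leq_trans (subset_leq_card sub) _.
apply: leq_trans (card_bigcup_le _ _ _) _.
rewrite -[X in (_ <= X * _)%N]card_ord -sum_nat_const.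
by apply: leq_sum => c _; rewrite card_powerset leq_exp2l// card_rough_cover_le.
Qed.

(** * Lower bound for the number of survivor sets *)

(** If every [x + q] with [q] in [T] is prime, every subset [B] of [T] can be
    removed exactly: for [q] in [B] the modulus [k q] takes the residue of [q],
    all other moduli take the residue of [- x] and so remove no element of
    [T]. *)
Lemma num_survivor_sets_ge (n x : nat) (T : {set 'I_n.+2}) (k : 'I_n.+2 -> nat) :
    (forall q, q \in T -> prime (x + q)) ->
    (forall q, q \in T -> (1 < k q < q)%N) ->
    {in T &, injective k} ->
    (forall q q', q \in T -> q' \in T -> q != q' -> (q != q' %[mod k q])%N) ->
  (2 ^ #|T| <= num_survivor_sets n)%N.
Proof.
move=> pT kT kinj kdiv.
pose rho (B : {set 'I_n.+2}) (j : nat) : nat :=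
  if [pick q in B | k q == j] is Some q then q : nat else (j - x %% j)%N.
(* [B] is recovered from the survivors as what is missing from [T] *)
have key (B : {set 'I_n.+2}) : B \subset T ->
    T :\: survivor (profile_of n (rho B)) = B.
  move=> BT; apply/finset.setP => q; rewrite finset.in_setD.
  have [qB|qB] := boolP (q \in B).
    have qT := fintype.subsetP BT _ qB; rewrite qT andbT.
    apply/negP => /mem_survivor[_ h].
    have /andP[k1 kq] := kT _ qT.
    have kn : (k q - 2 < n.-1)%N by have := ltn_ord q; lia.
    have e2 : (Ordinal kn).+2 = k q by rewrite /=; lia.
    apply: (h (Ordinal kn)); first by rewrite e2.
    rewrite profile_ofE e2 /rho; case: pickP => [q' /andP[q'B /eqP e]|/(_ q)].
      by rewrite (kinj q' q)// (fintype.subsetP BT).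
    by rewrite qB eqxx.
  have [qT|] := boolP (q \in T); last by rewrite andbF.
  rewrite andbT; apply/negbTE; rewrite negbK; apply/mem_survivor.
  have /andP[k1 kq] := kT _ qT.
  split; first exact: ltn_trans kq.
  move=> i iq; rewrite profile_ofE /rho; case: pickP => [q' /andP[q'B /eqP e]|_ e].
    have q'T := fintype.subsetP BT _ q'B.
    have q'q : q' != q by apply: contraNneq qB => <-.
    by move=> e2; have := kdiv _ _ q'T qT q'q; rewrite e e2 eqxx.
  have : (x + q = 0 %[mod i.+2])%N.
    rewrite -modnDmr e modnDmr.
    have xl := ltn_pmod x (isT : 0 < i.+2)%N.
    rewrite -modnDml subnKC ?modnn ?mod0n//; exact: ltnW.
  rewrite mod0n => /eqP; rewrite -/(dvdn _ _) => dv.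
  have := pT _ qT => /primeP[_ /(_ _ dv)]; rewrite /= => /eqP ee.
  by move: ee iq; clear; lia.
have inj : {in powerset T &, injective (fun B => survivor (profile_of n (rho B)))}.
  move=> B C; rewrite !powersetE => BT CT e.
  by rewrite -(key B BT) -(key C CT) e.
rewrite -card_powerset -(card_in_imset inj); apply: subset_leq_card.
by apply/fintype.subsetP => S /imsetP[B _ ->]; apply/imsetP; exists (profile_of n (rho B)).
Qed.

(** Distinct representatives can be chosen greedily from large enough sets. *)
Lemma greedy_sdr (A : eqType) (m : nat) (s : seq A) (cand : A -> {set 'I_m.+1}) :
    uniq s -> (forall a, a \in s -> (size s <= #|cand a|)%N) ->
  exists k : A -> 'I_m.+1,
    (forall a, a \in s -> k a \in cand a) /\ {in s &, injective k}.
Proof.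
elim: s => [|a s IH] /=; first by move=> _ _; exists (fun=> ord0).
move=> /andP[ans us] hs.
have [k [kc kinj]] := IH us (fun b bs => ltnW (hs b (mem_behead (s := a :: s) bs))).
have [y yc yk] : exists2 y, y \in cand a & y \notin map k s.
  apply: contrapT => no.
  have sub : cand a \subset map k s.
    apply/fintype.subsetP => y yc; apply: contrapT => /negP yk; apply: no.
    by exists y.
  have := leq_trans (subset_leq_card sub) (card_size _).
  by rewrite size_map leqNgt hs// mem_head.
exists (fun b => if b == a then y else k b); split => [b|b c].
  by rewrite inE; case: eqVneq => [->|_] //=; apply: kc.
rewrite !inE; case: eqVneq => [->|ba] /=; case: eqVneq => [->|ca] //=.
- by move=> _ cs e; case/negP: yk; rewrite e map_f.
- by move=> bs _ e; case/negP: yk; rewrite -e map_f.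
- exact: kinj.
Qed.

(** An integer [d > 0] has at most [d / w] divisors above [w]. *)
Lemma card_large_divisors (m w d : nat) : (0 < d)%N -> (0 < w)%N ->
  (#|[set k : 'I_m.+1 | (w < k)%N && (k %| d)%N]| <= d %/ w)%N.
Proof.
move=> d0 w0.
pose f (k : 'I_m.+1) : 'I_(d %/ w).+1 := inord (d %/ k).
have fv k : (w < k)%N -> (d %/ k <= d %/ w)%N by move=> wk; rewrite leq_div2l// ltnW.
have inj : {in [set k : 'I_m.+1 | (w < k)%N && (k %| d)%N] &, injective f}.
  move=> k l; rewrite !inE => /andP[wk kd] /andP[wl ld] /(congr1 val) /=.
  rewrite !inordK ?ltnS ?fv// => e; apply: val_inj.
  have : (d %/ l * k = d %/ l * l)%N by rewrite (divnK ld) -e divnK.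
  have dl0 : (0 < d %/ l)%N.
    by rewrite divn_gt0; [exact: dvdn_leq | exact: dvdn_gt0 ld].
  by move/eqP; rewrite (eqn_pmul2l dl0) => /eqP.
rewrite -(card_in_imset inj).
have sub : f @: [set k : 'I_m.+1 | (w < k)%N && (k %| d)%N] \subset [set~ ord0].
  apply/fintype.subsetP => _ /imsetP[k kd ->]; move: kd; rewrite !inE => /andP[wk kd].
  rewrite -val_eqE /= inordK ?ltnS ?fv// -lt0n divn_gt0; first exact: dvdn_leq.
  exact: leq_ltn_trans wk.
by apply: leq_trans (subset_leq_card sub) _; rewrite cardsC1 card_ord.
Qed.

(** When [T] is small compared with [w], distinct moduli [k q] in ]w, 2 w] can be
    found: each other element [q'] of [T] rules out only the few divisors of
    [q - q'] above [w]. *)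
Lemma num_survivor_sets_ge_primes (n x w : nat) (T : {set 'I_n.+2}) :
    (0 < w)%N ->
    (forall q, q \in T -> prime (x + q)) ->
    (forall q, q \in T -> (2 * w < q)%N) ->
    (#|T| * (n.+1 %/ w).+1 <= w)%N ->
  (2 ^ #|T| <= num_survivor_sets n)%N.
Proof.
move=> w0 pT wT Tw.
(* with truncated subtraction, the sum of both differences is |q - q'| *)
pose cand (q : 'I_n.+2) : {set 'I_(2 * w).+1} :=
  [set k : 'I_(2 * w).+1 | (w < k)%N] :\:
    \bigcup_(q' : 'I_n.+2 | (q' \in T) && (q' != q))
       [set k : 'I_(2 * w).+1 | (w < k)%N && (k %| (q - q') + (q' - q))%N].
have candP q k : k \in cand q -> (w < k)%N /\
    forall q', q' \in T -> q' != q -> (q != q' %[mod k])%N.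
  rewrite !inE => /andP[/bigcupP no wk]; split => // q' q'T q'q.
  apply/negP => e; apply: no; exists q'; first by rewrite q'T q'q.
  rewrite inE wk /=; case: (leqP q q') => qq.
    by rewrite (eqP (_ : q - q' == 0)%N) ?subn_eq0// add0n -eqn_mod_dvd// eq_sym.
  by rewrite (eqP (_ : q' - q == 0)%N) ?subn_eq0 1?ltnW// addn0 -eqn_mod_dvd// ltnW.
have wcard : (w <= #|[set k : 'I_(2 * w).+1 | (w < k)%N]|)%N.
  have inj : injective (fun j : 'I_w => inord (w + j).+1 : 'I_(2 * w).+1).
    have bound (i : 'I_w) : ((w + i).+1 < (2 * w).+1)%N.
      by rewrite ltnS mul2n -addnn ltn_add2l.
    by move=> i j /(congr1 (@nat_of_ord _)); rewrite !inordK// => -[/addnI/val_inj].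
  rewrite -[X in (X <= _)%N]card_ord -(card_codom inj); apply: subset_leq_card.
  apply/fintype.subsetP => _ /codomP[j ->]; rewrite inE inordK ?ltnS.
    by rewrite leq_addr.
  by have := ltn_ord j; lia.
have ccard q : q \in T -> (#|T| <= #|cand q|)%N.
  move=> qT.
  have bad : (#|\bigcup_(q' : 'I_n.+2 | (q' \in T) && (q' != q))
       [set k : 'I_(2 * w).+1 | (w < k)%N && (k %| (q - q') + (q' - q))%N]|
       <= #|T| * (n.+1 %/ w))%N.
    rewrite -sum_nat_const big_mkcond [X in (_ <= X)%N]big_mkcond /=.
    apply: leq_trans (card_bigcup_le _ _ _) _; apply: leq_sum => q' _.
    case: (q' \in T) => //=; last by rewrite cards0.
    case: eqVneq => [_|q'q] /=; first by rewrite cards0.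
    apply: leq_trans (card_large_divisors _ _ _ _ w0) _.
      by move: q'q; rewrite -val_eqE /=; lia.
    by apply: leq_div2r; have := ltn_ord q; have := ltn_ord q'; lia.
  have := cardsD [set k : 'I_(2 * w).+1 | (w < k)%N] (\bigcup_(q' : 'I_n.+2 | (q' \in T) && (q' != q))
       [set k : 'I_(2 * w).+1 | (w < k)%N && (k %| (q - q') + (q' - q))%N]).
  rewrite -/(cand q) => ->.
  have : (#|[set k : 'I_(2 * w).+1 | (w < k)%N] :&: \bigcup_(q' : 'I_n.+2 | (q' \in T) && (q' != q))
       [set k : 'I_(2 * w).+1 | (w < k)%N && (k %| (q - q') + (q' - q))%N]| <= #|T| * (n.+1 %/ w))%N.
    by apply: leq_trans bad; apply: subset_leq_card; apply: finset.subsetIr.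
  rewrite mulnS in Tw; move: wcard Tw; lia.
have [|k [kc kinj]] := @greedy_sdr _ _ (enum T) cand (enum_uniq _).
  by move=> q; rewrite mem_enum -cardE; exact: ccard.
apply: (@num_survivor_sets_ge n x T (fun q => k q)) => //.
- move=> q qT; have /candP[wk _] : k q \in cand q by apply: kc; rewrite mem_enum.
  rewrite (leq_ltn_trans w0 wk)/=; apply: leq_ltn_trans (wT _ qT).
  by rewrite -ltnS.
- move=> q q' qT q'T /val_inj; apply: kinj; by rewrite mem_enum.
- move=> q q' qT q'T qq'; have /candP[_] : k q \in cand q by apply: kc; rewrite mem_enum.
  by apply => //; rewrite eq_sym.
Qed.

(** * Primes in windows of length n *)

Lemma primes_in_cat (a b c : nat) : (a <= b <= c)%N ->
  primes_in a c = (primes_in a b + primes_in b c)%N.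
Proof.
move=> /andP[ab bc]; rewrite /primes_in -count_cat; congr count.
rewrite /index_iota; have -> : (c.+1 - a.+1 = (b.+1 - a.+1) + (c.+1 - b.+1))%N by lia.
by rewrite iotaD; congr (_ ++ iota _ _); lia.
Qed.

Lemma primes_in_le (a b : nat) : (primes_in a b <= b - a)%N.
Proof. by apply: leq_trans (count_size _ _) _; rewrite size_iota; lia. Qed.

(** Cut [1, M] into an initial segment of length [2 w] and consecutive windows
    of length [n + 1 - 2 w]. *)
Lemma primes_in_windows (n w M t : nat) : (2 * w <= n)%N ->
    (forall x, primes_in (x + 2 * w) (x + n.+1) <= t)%N ->
  (primes_in 0 M <= 2 * w + (M %/ (n.+1 - 2 * w)).+1 * t)%N.
Proof.
move=> wn h; set l := (n.+1 - 2 * w)%N.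
have l0 : (0 < l)%N by rewrite /l; lia.
have lE : (l + 2 * w = n.+1)%N by rewrite /l; lia.
have hJ J : (primes_in 0 (2 * w + J * l) <= 2 * w + J * t)%N.
  elim: J => [|J IH]; first by rewrite !addn0; apply: leq_trans (primes_in_le _ _) _; lia.
  rewrite (@primes_in_cat 0 (2 * w + J * l)); last by rewrite mulSn; lia.
  have := h (J * l)%N.
  have -> : (J * l + n.+1 = 2 * w + J.+1 * l)%N by rewrite mulSn -lE; lia.
  by rewrite [(J * l + 2 * w)%N]addnC [(J.+1 * t)%N]mulSn; lia.
apply: leq_trans (hJ _).
rewrite (@primes_in_cat 0 M (2 * w + _)) ?leq_addr//=.
apply: leq_trans (ltnW (ltn_ceil M l0)) _; exact: leq_addl.
Qed.

Lemma exists_subset_card (T : finType) (A : {set T}) (t : nat) : (t <= #|A|)%N ->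
  exists2 B : {set T}, B \subset A & #|B| = t.
Proof.
move=> tA; exists [set x in take t (enum A)].
  by apply/fintype.subsetP => x; rewrite inE => /mem_take; rewrite mem_enum.
rewrite cardsE; have /card_uniqP -> := take_uniq t (enum_uniq A).
by rewrite size_take -cardE; case: ltngtP tA.
Qed.

(** By the pigeonhole principle, an [M] rich in primes provides a window with at
    least [t] primes. *)
Lemma num_survivor_sets_ge_pow (n w M t : nat) :
    (0 < w)%N -> (2 * w <= n)%N -> (t * (n.+1 %/ w).+1 <= w)%N ->
    (2 * w + (M %/ (n.+1 - 2 * w)).+1 * t < primes_in 0 M)%N ->
  (2 ^ t <= num_survivor_sets n)%N.
Proof.
move=> w0 wn tw hM.
have [x hx] : exists x, (t <= primes_in (x + 2 * w) (x + n.+1))%N.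
  apply: contrapT => no; move: hM; rewrite ltnNge => /negP; apply.
  apply: primes_in_windows => // x; rewrite leqNgt; apply/negP => hx.
  by apply: no; exists x; apply: ltnW.
(* the translated primes of the window, of which [t] are kept *)
pose T0 := [set q : 'I_n.+2 | (2 * w < q)%N && prime (x + q)].
have cT0 : #|T0| = primes_in (x + 2 * w) (x + n.+1).
  rewrite -sum1dep_card /primes_in -sum1_count big_mkcond /=.
  rewrite -(big_mkord xpredT (fun q => if (2 * w < q)%N && prime (x + q) then 1 else 0)%N).
  rewrite (@big_cat_nat _ _ _ (2 * w).+1)//=; last by lia.
  rewrite big1_seq ?add0n; last first.
    by move=> q; rewrite mem_index_iota /=; case: ltnP => //; lia.
  rewrite -[(x + 2 * w).+1]addnS [(x + (2 * w).+1)%N]addnC big_addn.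
  have -> : ((x + n.+1).+1 - x = n.+2)%N by lia.
  rewrite [RHS]big_mkcond big_nat_cond [RHS]big_nat_cond; apply: eq_bigr => q /andP[/andP[wq _] _].
  by rewrite wq addnC.
have [|T TT0 cT] := exists_subset_card _ T0 t; first by rewrite cT0.
rewrite -cT; apply: (@num_survivor_sets_ge_primes n x w T w0); last by rewrite cT.
- by move=> q /(fintype.subsetP TT0); rewrite inE => /andP[].
- by move=> q /(fintype.subsetP TT0); rewrite inE => /andP[].
Qed.

(** * The asymptotic lower bound *)

Lemma ln2_le1 (R : realType) : ln (2 : R) <= 1.
Proof. by rewrite -[2]/(1 + 1); apply: le_ln1Dx; lra. Qed.

Lemma ln2_gt0 (R : realType) : 0 < ln (2 : R).
Proof. by apply: ln_gt0; lra. Qed.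

Lemma expR_ge_sqr (R : realType) (x : R) : 0 <= x -> x ^+ 2 / 2 <= expR x.
Proof. by move=> x0; apply: le_trans (expR_ge1Dxn 1 x0); rewrite lerDr. Qed.

Lemma num_survivor_sets_gt0 (n : nat) : (0 < num_survivor_sets n)%N.
Proof.
rewrite /num_survivor_sets card_gt0; apply/set0Pn.
by exists (survivor (profile_of n (fun=> 0%N))); apply/imsetP; exists (profile_of n (fun=> 0%N)).
Qed.

Lemma log_ratio_ge (R : realType) (n t : nat) : (1 < n)%N ->
  (2 ^ t <= num_survivor_sets n)%N ->
  t%:R * ln 2 * (ln n%:R / n%:R) <= log_ratio R n.
Proof.
move=> n1 h; rewrite /log_ratio invf_div ler_wpM2r//.
  by rewrite divr_ge0// ln_nat_ge0.
rewrite mulr_natl -lnXn// -natrX ler_ln ?posrE ?ltr0n ?expn_gt0//.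
  by rewrite ler_nat.
exact: num_survivor_sets_gt0.
Qed.

(** With [u = ln n], the prime-rich [M] is found between [n s] and [n s L], where
    [s] is about [exp (e u)]: large compared with [u / e], yet [ln s <= e u]. *)
Lemma exists_prime_rich (R : realType) (e : R) (n L : nat) :
    0 < e < 20%:R^-1 -> (1 < n)%N -> (0 < L)%N -> 5 < e * ln (L%:R : R) ->
    ln L%:R <= e * ln n%:R -> 8 / e ^+ 3 <= ln n%:R -> 0 < ln (n%:R : R) ->
  exists s M : nat, [/\ (1 + 2 * e) * ln (n%:R : R) <= e * s%:R,
    (n * s <= M)%N &
    (1 - e) * M%:R <= (primes_in 0 M)%:R * ((1 + 2 * e) * ln (n%:R : R))].
Proof.
move=> /andP[e0 e20] n1 L0 L5; set u := ln n%:R => uL u8 u0.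
have [e1 e_lt1] : e < 1 / 20 /\ e < 1 by split; lra.
pose s := Num.truncn (expR (e * u)).
have s_le : s%:R <= expR (e * u) by rewrite truncn_le expR_ge0.
have s_gt : expR (e * u) < s%:R + 1 by rewrite natr1; apply: truncnS_gt.
have eu2 : 4 * u / e <= expR (e * u).
  apply: le_trans (expR_ge_sqr _ _ _); last by rewrite mulr_ge0// ltW.
  have c0 : 0 <= e ^+ 2 * u / 2 by rewrite !mulr_ge0 ?exprn_ge0// ltW.
  have := ler_wpM2l c0 u8.
  have -> : e ^+ 2 * u / 2 * (8 / e ^+ 3) = 4 * u / e by field; rewrite gt_eqF.
  move=> h; apply: le_trans h _.
  by rewrite le_eqVlt; apply/orP; left; apply/eqP; field.
have e8 : 1 <= 8 / e ^+ 3.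
  rewrite ler_pdivlMr ?exprn_gt0// mul1r.
  apply: (@le_trans _ _ 1); last by rewrite ler1n.
  by rewrite exprn_ile1// ltW.
have sV : (1 + 2 * e) * u <= e * s%:R.
  have h1 : 4 * u <= e * expR (e * u) by rewrite -ler_pdivrMl// mulrC.
  have h2 : e * expR (e * u) <= e * s%:R + e.
    by rewrite -[X in _ + X]mulr1 -mulrDr ler_pM2l// ltW.
  have h3 : e * u <= u by rewrite ler_piMl ?ltW.
  clear -h1 h2 h3 e8 u8 e_lt1; lra.
have s0 : (0 < s)%N.
  have : 0 < e * s%:R by apply: lt_le_trans sV; rewrite mulr_gt0//; clear -e0; lra.
  by rewrite pmulr_rgt0// ltr0n.
pose A := (n * s)%N; pose B := (A * L)%N.
have A0 : (0 < A)%N by rewrite muln_gt0 s0 ltnW.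
have AB : (A <= B)%N by rewrite leq_pmulr.
have lnB : ln B%:R = ln A%:R + ln L%:R :> R by rewrite /B natrM lnM ?posrE ?ltr0n.
have lnA : ln A%:R = u + ln s%:R :> R.
  by rewrite /A natrM lnM ?posrE ?ltr0n// ltnW.
have lns : ln s%:R <= e * u.
  by rewrite -[X in _ <= X]expRK ler_ln ?posrE ?expR_gt0 ?ltr0n.
have e01 : 0 < e < 1 by rewrite e0.
have [|M /andP[AM MB] thM] := @theta_large R e A B e01 A0 AB.
  by rewrite lnB addrAC subrr add0r.
exists s, M; split => //.
apply: le_trans thM _; apply: le_trans (theta_le_count R M) _; apply: ler_wpM2l => //.
apply: (@le_trans _ _ (ln B%:R)); first by apply: ln_nat_le => //; apply: leq_trans AM.
rewrite lnB lnA; clear -uL lns; lra.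
Qed.

Lemma exists_threshold (R : realType) (e u : R) (n t : nat) :
    0 < e < 20%:R^-1 -> (0 < n)%N -> 0 < u -> 2 <= e * n%:R ->
    2 / e * (4 / e + 1) <= u -> t%:R <= n%:R / u ->
  exists w : nat, [/\ (0 < w)%N, w%:R <= e * n%:R & (t * (n.+1 %/ w).+1 <= w)%N].
Proof.
move=> /andP[e0 e20] n0N u0 en2 u4 tn; have n0 : (0 : R) < n%:R by rewrite ltr0n.
pose w := Num.truncn (e * n%:R); exists w.
have w_le : w%:R <= e * n%:R by rewrite truncn_le mulr_ge0// ltW.
have w_ge : e * n%:R / 2 <= w%:R.
  have : e * n%:R < w%:R + 1 by rewrite natr1; apply: truncnS_gt.
  by clear -en2; lra.
have w0 : (0 < w)%N by rewrite -(ltr0n R); clear -w_ge en2; lra.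
split => //; rewrite -(ler_nat R) natrM; apply: (le_trans _ w_ge).
have q : (n.+1 %/ w)%N%:R <= 4 / e :> R.
  apply: (@le_trans _ _ (n.+1%:R / w%:R)).
    by rewrite ler_pdivlMr ?ltr0n// -natrM ler_nat leq_divM.
  rewrite ler_pdivrMr ?ltr0n//.
  have e4 : 0 <= 4 / e by rewrite divr_ge0// ltW.
  apply: le_trans (ler_wpM2l e4 w_ge).
  have -> : 4 / e * (e * n%:R / 2) = 2 * n%:R by field; rewrite gt_eqF.
  by rewrite -natrM ler_nat mul2n -addnn; clear -n0N; lia.
apply: (@le_trans _ _ (n%:R / u * (4 / e + 1))).
  by apply: ler_pM => //; rewrite -natr1 lerD2r.
rewrite mulrAC ler_pdivrMr//.
have c0 : 0 <= e * n%:R / 2 by rewrite !mulr_ge0// ltW.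
apply: le_trans (ler_wpM2l c0 u4).
by rewrite le_eqVlt; apply/orP; left; apply/eqP; field; rewrite gt_eqF.
Qed.

(** The arithmetic of the pigeonhole: [M] contains more primes than windows
    with at most [t] primes each would allow. *)
Lemma window_budget (R : realFieldType) (e u n s M w q t : R) :
    0 < e < 20%:R^-1 -> 1 <= u -> 0 < n -> 0 <= q -> 0 <= t -> 0 <= w ->
    2 * w <= n -> t * u <= (1 - 8 * e) * n -> (1 + 2 * e) * u <= e * s ->
    n * s <= M -> q * ((1 - 2 * e) * n) <= M ->
  (2 * w + (q + 1) * t) * ((1 + 2 * e) * u) < (1 - e) * M.
Proof.
move=> /andP[e0 e20] u1 n0 q0 t0 w0 wn tu us nsM qM.
have e1 : e < 1 / 20 by lra.
have esM : e * s * n <= e * M by rewrite -mulrA ler_pM2l// mulrC.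
have V1 : 1 <= (1 + 2 * e) * u by clear -e0 u1; nra.
have V0 : 0 <= (1 + 2 * e) * u by clear -V1; lra.
have es1 : 1 <= e * s by apply: (le_trans _ us).
have neM : n <= e * M by apply: (le_trans _ esM); apply: ler_peMl => //; exact: ltW.
have M0 : 0 < M.
  by have := lt_le_trans n0 neM; rewrite pmulr_rgt0.
have a1 : 2 * w * ((1 + 2 * e) * u) <= e * M.
  apply: (le_trans _ esM); rewrite mulrC.
  by apply: ler_pM => //; rewrite mulr_ge0.
have a2 : (q + 1) * n <= (1 + 4 * e) * M.
  have d0 : 0 < 1 - 2 * e by clear -e1; lra.
  have : q * n <= (1 + 3 * e) * M.
    rewrite -(ler_pM2l d0) mulrCA; apply: le_trans qM _.
    rewrite mulrA ler_peMl ?(ltW M0)//; clear -e0 e1; nra.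
  by rewrite mulrDl mul1r; clear -neM; lra.
have c0 : 0 <= (1 - 8 * e) * (1 + 2 * e) by apply: mulr_ge0; clear -e0 e1; lra.
have a3 : t * ((1 + 2 * e) * u) <= (1 - 8 * e) * (1 + 2 * e) * n.
  rewrite mulrCA mulrAC [X in _ <= X]mulrC; apply: ler_wpM2l => //.
  by clear -e0; lra.
have a4 : (q + 1) * t * ((1 + 2 * e) * u) <=
    (1 - 8 * e) * (1 + 2 * e) * ((1 + 4 * e) * M).
  rewrite -mulrA.
  apply: (@le_trans _ _ ((q + 1) * ((1 - 8 * e) * (1 + 2 * e) * n))).
    by apply: ler_wpM2l => //; rewrite addr_ge0.
  by rewrite mulrCA ler_wpM2l.
rewrite mulrDl; apply: le_lt_trans (lerD a1 a4) _.
by rewrite mulrA -mulrDl ltr_pM2r//; clear -e0 e1; nra.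
Qed.

Lemma log_ratio_lower (R : realType) (e : R) : 0 < e < 20%:R^-1 ->
  exists U : R, forall n : nat, (1 < n)%N -> U <= ln n%:R ->
    (1 - 9 * e) * ln 2 <= log_ratio R n.
Proof.
move=> /[dup] e020 /andP[e0 e20].
(* [theta_large] applies to the intervals [A, L A] *)
pose L := (Num.truncn (expR (5 / e))).+1.
have L5 : 5 < e * ln (L%:R : R).
  have : expR (5 / e) < L%:R by apply: truncnS_gt.
  rewrite -ltr_ln ?posrE ?expR_gt0 ?ltr0n// expRK.
  by rewrite ltr_pdivrMr// mulrC.
have ei0 : 0 < e^-1 by rewrite invr_gt0.
have p1 : 0 <= ln (L%:R : R) / e by rewrite mulr_ge0 ?(ltW ei0)// ln_nat_ge0.
have p2 : 0 <= 8 / e ^+ 3 by rewrite divr_ge0 ?exprn_ge0// ltW.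
have p4 : 0 <= 2 / e by rewrite divr_ge0// ltW.
have p3 : 0 <= 2 / e * (4 / e + 1) by rewrite mulr_ge0// addr_ge0// divr_ge0// ltW.
exists (2 + ln L%:R / e + 8 / e ^+ 3 + 2 / e * (4 / e + 1) + 2 / e) => n n1.
set u := ln n%:R => Un.
have [u1 uL u8 u4 u2] : [/\ 2 <= u, ln L%:R / e <= u, 8 / e ^+ 3 <= u,
    2 / e * (4 / e + 1) <= u & 2 / e <= u].
  move: p1 p2 p3 p4 Un; clear.
  move: (ln L%:R / e) (8 / e ^+ 3) (2 / e * (4 / e + 1)) (2 / e) => a b c d *.
  by split; lra.
have u0 : 0 < u by clear -u1; lra.
have n0 : (0 : R) < n%:R by rewrite ltr0n ltnW.
have unn : u <= e * n%:R.
  have nE : n%:R = expR u :> R by rewrite lnK// posrE.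
  have un : u ^+ 2 / 2 <= n%:R by rewrite nE expR_ge_sqr// ltW.
  have eu : 2 <= e * u by rewrite mulrC -ler_pdivrMr.
  apply: le_trans (ler_wpM2l (ltW e0) un).
  have -> : e * (u ^+ 2 / 2) = (e * u / 2) * u by field.
  by rewrite ler_peMl ?(ltW u0)//; clear -eu; lra.
have en2 : 2 <= e * n%:R by apply: (le_trans _ unn).
(* [y] is the number of primes wanted in a window *)
pose y := (1 - 8 * e) * (n%:R / u).
have nu0 : 0 < n%:R / u by rewrite divr_gt0.
have y0 : 0 <= y by rewrite /y mulr_ge0 ?(ltW nu0)//; clear -e20; lra.
pose t := Num.truncn y.
have t_le : t%:R <= y by rewrite truncn_le.
have t_gt : y < t%:R + 1 by rewrite natr1; apply: truncnS_gt.
have tnu : t%:R <= n%:R / u.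
  by apply: le_trans t_le _; rewrite ler_piMl ?(ltW nu0)//; clear -e0; lra.
have [w [w0 w_le tw]] := exists_threshold R e u n t e020 (ltnW n1) u0 en2 u4 tnu.
have ewn : 2 * e * n%:R <= n%:R by rewrite ler_piMl ?(ltW n0)//; clear -e20; lra.
have wnR : 2 * w%:R <= n%:R :> R by apply: (le_trans _ ewn); rewrite -mulrA ler_pM2l.
have wn : (2 * w <= n)%N by rewrite -(ler_nat R) natrM.
rewrite ler_pdivrMr// mulrC in uL.
have [s [M [sV AM piM]]] := exists_prime_rich R e n L e020 n1 isT L5 uL u8 u0.
have V0 : 0 < (1 + 2 * e) * u by rewrite mulr_gt0//; clear -e0; lra.
have hM : (2 * w + (M %/ (n.+1 - 2 * w)).+1 * t < primes_in 0 M)%N.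
  set l := (n.+1 - 2 * w)%N.
  have lR : (1 - 2 * e) * n%:R <= l%:R.
    rewrite /l natrB ?natrM; last exact: leq_trans wn _.
    by rewrite -natr1; clear -w_le; lra.
  rewrite -(ltr_nat R) natrD !natrM -[(M %/ l).+1%:R]natr1 -(ltr_pM2r V0).
  apply: lt_le_trans piM; apply: (window_budget _ _ _ n%:R s%:R) => //.
  - by clear -u1; lra.
  - by apply: le_trans (ler_wpM2r (ltW u0) t_le) _; rewrite /y -mulrA divfK ?gt_eqF.
  - by rewrite -natrM ler_nat.
  - apply: (@le_trans _ _ ((M %/ l)%N%:R * l%:R)); first exact: ler_wpM2l.
    by rewrite -natrM ler_nat leq_divM.
have := num_survivor_sets_ge_pow n w M t w0 wn tw hM.
move=> /(log_ratio_ge R n t n1); apply: le_trans.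
rewrite mulrAC ler_wpM2r ?(ltW (ln2_gt0 R))// -/u.
have un0 : 0 <= u / n%:R by rewrite divr_ge0// ltW.
have h1 : y - 1 <= t%:R by clear -t_gt; lra.
apply: le_trans (ler_wpM2r un0 h1).
have -> : (y - 1) * (u / n%:R) = (1 - 8 * e) - u / n%:R.
  by rewrite /y; field; rewrite !gt_eqF.
have : u / n%:R <= e by rewrite ler_pdivrMr.
by clear; lra.
Qed.

(** * The asymptotic upper bound *)

Lemma ln_num_survivor_sets_le (R : realType) (n K : nat) : (0 < K)%N ->
  ln ((num_survivor_sets n)%:R : R) <=
    K%:R ^+ 2 + K.+1%:R + K.+1%:R ^+ 2 + ln 2 * (n.+1%:R / ln K.+1%:R).
Proof.
move=> K0.
have lK : 0 < ln (K.+1%:R : R) by apply: ln_nat_gt0.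
have mass := ln_le_mass R K.
pose z : R := n.+1%:R / ln K.+1%:R + K.+1%:R ^+ 2.
have q0 : 0 <= n.+1%:R / ln (K.+1%:R : R) by rewrite divr_ge0// ltW.
have z0 : 0 <= z by rewrite addr_ge0// exprn_ge0.
pose b := Num.truncn z.
have b_le : b%:R <= z by rewrite truncn_le.
have rough_le c : (\sum_(c.+1 <= m < (c + n.+1).+1) rough K m <= b)%N.
  rewrite truncn_ge_nat// natr_sum.
  apply: le_trans (selberg_sieve R K c n.+1 K0) _.
  rewrite lerD2r ler_wpM2l// lef_pV2 ?posrE//; exact: lt_le_trans mass.
have N0 := num_survivor_sets_gt0 n.
apply: (@le_trans _ _ (ln (K`! * 2 ^ (K.+1 + b))%:R)).
  exact: ln_nat_le (num_survivor_sets_le n K b rough_le).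
rewrite natrM lnM ?posrE ?ltr0n ?fact_gt0 ?expn_gt0// natrX lnXn//.
have lf : ln (K`!%:R : R) <= K%:R ^+ 2.
  apply: le_trans (ln_fact_le R K) _; rewrite expr2 ler_wpM2l//.
  by rewrite ltW// ln_sublinear// ltr0n.
rewrite -addrA -addrA; apply: lerD lf _.
rewrite -[ln 2 *+ _]mulr_natl natrD mulrDl.
have l2 := ln2_le1 R; have l20 := ln2_gt0 R.
apply: lerD; first by rewrite ler_piMr.
apply: le_trans (ler_wpM2r (ltW l20) b_le) _.
rewrite /z mulrDl [X in X <= _]addrC; apply: lerD; last by rewrite [X in X <= _]mulrC.
by rewrite ler_piMr// exprn_ge0.
Qed.

(** The level of the sieve is [n ^ a] with [a = (1 - g) / 2] slightly below one
    half, so that its square is negligible against [n / ln n]. *)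
Lemma log_ratio_upper (R : realType) (g : R) : 0 < g < 2^-1 ->
  exists U : R, forall n : nat, (1 < n)%N -> U <= ln n%:R ->
    log_ratio R n <= 2 * ln 2 + 6 * g.
Proof.
move=> /andP[g0 g2].
have g12 : g < 1 / 2 by clear -g2; lra.
have p1 : 0 <= 14 / g ^+ 3 by rewrite divr_ge0 ?exprn_ge0// ltW.
have p2 : 0 <= 4 / g by rewrite divr_ge0// ltW.
exists (1 + 14 / g ^+ 3 + 4 / g) => n n1; set u := ln n%:R => Un.
have [u1 u14 u4] : [/\ 1 <= u, 14 / g ^+ 3 <= u & 4 / g <= u].
  by move: p1 p2 Un; clear; move: (14 / g ^+ 3) (4 / g) => *; split; lra.
have u0 : 0 < u by apply: lt_le_trans u1.
have n0 : (0 : R) < n%:R by rewrite ltr0n ltnW.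
have nE : n%:R = expR u :> R by rewrite lnK// posrE.
pose a := (1 - g) / 2.
have a0 : 1 / 4 <= a by rewrite /a; clear -g12; lra.
have a00 : 0 < a by clear -a0; lra.
pose y := expR (a * u).
have y1 : 1 <= y by rewrite /y -expR0 ler_expR mulr_ge0 ?ltW.
pose K := Num.truncn y.
have K_le : K%:R <= y by rewrite truncn_le expR_ge0.
have K_gt : y < K.+1%:R by apply: truncnS_gt.
have K0 : (0 < K)%N by rewrite truncn_gt0.
have lK : a * u <= ln K.+1%:R.
  by rewrite -[X in X <= _]expRK ler_ln ?posrE ?expR_gt0// ltW.
have au0 : 0 < a * u by rewrite mulr_gt0.
have KS : K.+1%:R <= 2 * y by rewrite -natr1; clear -K_le y1; lra.
have K2 : (K%:R : R) ^+ 2 <= y ^+ 2 by rewrite lerXn2r ?nnegrE ?expR_ge0.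
have KS2 : (K.+1%:R : R) ^+ 2 <= 4 * y ^+ 2.
  have -> : 4 * y ^+ 2 = (2 * y) ^+ 2 by ring.
  by rewrite lerXn2r ?nnegrE ?mulr_ge0 ?expR_ge0.
have yy : y <= y ^+ 2 by rewrite expr2 ler_peMl// expR_ge0.
have lnN : ln ((num_survivor_sets n)%:R : R) <= 7 * y ^+ 2 + ln 2 * (n.+1%:R / (a * u)).
  apply: le_trans (ln_num_survivor_sets_le R n K K0) _.
  apply: lerD; first by clear -K2 KS KS2 yy; lra.
  rewrite ler_wpM2l ?(ltW (ln2_gt0 R))// ler_wpM2l// lef_pV2 ?posrE//.
  exact: lt_le_trans lK.
have y2 : y ^+ 2 * u <= (g / 7) * n%:R.
  have e1 : n%:R = y ^+ 2 * expR (g * u).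
    by rewrite nE /y expr2 -!expRD; congr expR; rewrite /a; field.
  rewrite e1 mulrCA; apply: ler_wpM2l; first by rewrite exprn_ge0// expR_ge0.
  have g7 : 0 <= g / 7 by rewrite divr_ge0// ltW.
  apply: le_trans (ler_wpM2l g7 (expR_ge_sqr _ _ _)); last by rewrite mulr_ge0 ?ltW.
  have -> : g / 7 * ((g * u) ^+ 2 / 2) = g ^+ 3 * u / 14 * u by field.
  rewrite ler_peMl ?(ltW u0)// ler_pdivlMr// mul1r mulrC -ler_pdivrMr//.
  exact: exprn_gt0.
rewrite /log_ratio invf_div -/u.
have un0 : 0 <= u / n%:R by rewrite divr_ge0// ltW.
apply: le_trans (ler_wpM2r un0 lnN) _.
rewrite mulrDl.
have h1 : 7 * y ^+ 2 * (u / n%:R) <= g.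
  rewrite mulrA ler_pdivrMr// -mulrA.
  by move: y2; clear; move: (y ^+ 2 * u) => *; lra.
have ia : a^-1 <= 2 + 4 * g.
  rewrite -[_^-1]mul1r ler_pdivrMr// /a; clear -g0 g12; nra.
have ia4 : a^-1 <= 4 by apply: le_trans ia _; clear -g12; lra.
have in4 : n%:R^-1 <= g / 4.
  have un : u <= n%:R.
    by rewrite nE; apply: le_trans (expR_ge1Dx u); rewrite lerDr.
  have g4 : 0 < 4 / g by rewrite divr_gt0.
  have -> : g / 4 = (4 / g)^-1 by rewrite invf_div.
  by rewrite lef_pV2 ?posrE//; apply: le_trans un.
have h2 : ln 2 * (n.+1%:R / (a * u)) * (u / n%:R) <= 2 * ln 2 + 5 * g.
  have -> : ln 2 * (n.+1%:R / (a * u)) * (u / n%:R) =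
      ln 2 * a^-1 + ln 2 * (a^-1 * n%:R^-1).
    by rewrite -natr1; field; rewrite !gt_eqF.
  have l2 := ln2_le1 R; have l20 := ln2_gt0 R.
  have m1 : ln 2 * a^-1 <= ln 2 * (2 + 4 * g) by rewrite ler_pM2l.
  have m2 : ln 2 * (4 * g) <= 4 * g by rewrite ler_piMl// mulr_ge0// ltW.
  have m3 : a^-1 * n%:R^-1 <= 4 * (g / 4).
    by apply: ler_pM => //; rewrite invr_ge0 ltW.
  have m4 : ln 2 * (a^-1 * n%:R^-1) <= g.
    apply: le_trans (_ : a^-1 * n%:R^-1 <= _).
      by rewrite ler_piMl// mulr_ge0// invr_ge0 ltW.
    by move: m3; clear; lra.
  by clear -m1 m2 m4; lra.
by clear -h1 h2; lra.
Qed.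

(** * Limits *)

Local Open Scope classical_set_scope.
Local Open Scope ring_scope.

Lemma limn_esup_le_near (R : realType) (v : nat -> R) (c : R) (N : nat) :
  (forall n, (N <= n)%N -> v n <= c) ->
  (limn_esup (fun n => (v n)%:E) <= c%:E)%E.
Proof.
move=> h; rewrite /limn_esup /limf_esup; apply: ge_ereal_inf.
exists (ereal_sup [set (v n)%:E | n in [set n | (N <= n)%N]]).
  by exists [set n | (N <= n)%N] => //; exact: nbhs_infty_ge.
by apply: ge_ereal_sup => _ [n /= Nn <-]; rewrite lee_fin h.
Qed.

Lemma limn_einf_ge_near (R : realType) (v : nat -> R) (c : R) (N : nat) :
  (forall n, (N <= n)%N -> c <= v n) ->
  (c%:E <= limn_einf (fun n => (v n)%:E))%E.
Proof.
move=> h; rewrite /limn_einf leeNr -EFinN.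
by apply: (@limn_esup_le_near R (fun n => - v n) _ N) => n /h; rewrite lerN2.
Qed.

Lemma ln_ge_near (R : realType) (U : R) :
  exists2 N : nat, (1 < N)%N & forall n, (N <= n)%N -> U <= ln (n%:R : R).
Proof.
exists (Num.truncn (expR U)).+2 => // n Nn.
have h : expR U < (Num.truncn (expR U)).+1%:R by apply: truncnS_gt.
rewrite -[X in X <= _]expRK ler_ln ?posrE ?expR_gt0 ?ltr0n//; last exact: leq_trans Nn.
by apply: le_trans (ltW h) _; rewrite ler_nat ltnW.
Qed.

Theorem corollary13 (R : realType) :
  [/\ ((ln 2 : R)%:E <= limn_einf (fun n => (log_ratio R n)%:E))%E,
      (limn_einf (fun n => (log_ratio R n)%:E)
         <= limn_esup (fun n => (log_ratio R n)%:E))%E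
    & (limn_esup (fun n => (log_ratio R n)%:E) <= (2 * ln 2 : R)%:E)%E]
  /\ (forall C : R, log_ratio R n @[n --> \oo] --> C ->
        C \in `[ln 2, 2 * ln 2]).
Proof.
have inf : ((ln 2 : R)%:E <= limn_einf (fun n => (log_ratio R n)%:E))%E.
  apply/lee_subgt0Pr => e e0; rewrite -EFinB.
  pose d := Num.min (e / 9) 21%:R^-1.
  have d0 : 0 < d by rewrite lt_min divr_gt0//= invr_gt0.
  have d20 : 0 < d < 20%:R^-1.
    rewrite d0 gt_min; apply/orP; right; rewrite ltf_pV2 ?posrE//.
    by rewrite ltr_nat.
  have d9 : 9 * d <= e by rewrite -ler_pdivlMl// ge_min mulrC lexx.
  have [U hU] := log_ratio_lower R d d20.
  have [N N1 hN] := ln_ge_near R U.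
  apply: (@limn_einf_ge_near R _ _ N) => n Nn.
  apply: le_trans (hU n (leq_trans N1 Nn) (hN n Nn)).
  have l2 := ln2_le1 R; have l20 := ln2_gt0 R.
  have : 9 * d * ln 2 <= 9 * d by rewrite ler_piMr// mulr_ge0// ltW.
  by rewrite mulrBl mul1r; clear -d9; lra.
have sup : (limn_esup (fun n => (log_ratio R n)%:E) <= (2 * ln 2 : R)%:E)%E.
  apply/lee_addgt0Pr => e e0; rewrite -EFinD.
  pose d := Num.min (e / 6) 3%:R^-1.
  have d0 : 0 < d by rewrite lt_min divr_gt0//= invr_gt0.
  have d2 : 0 < d < 2^-1.
    rewrite d0 gt_min; apply/orP; right; rewrite ltf_pV2 ?posrE//.
    by rewrite ltr_nat.
  have d6 : 6 * d <= e by rewrite -ler_pdivlMl// ge_min mulrC lexx.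
  have [U hU] := log_ratio_upper R d d2.
  have [N N1 hN] := ln_ge_near R U.
  apply: (@limn_esup_le_near R _ _ N) => n Nn.
  by apply: le_trans (hU n (leq_trans N1 Nn) (hN n Nn)) _; rewrite lerD2l.
split; first by split => //; exact: limn_einf_sup.
move=> C cvC.
have cvE : (log_ratio R n)%:E @[n --> \oo] --> C%:E by apply: cvg_EFin cvC; exact: nearW.
have [ie se] := cvg_limn_einf_sup cvE.
by rewrite in_itv /= -!lee_fin -{1}ie -se inf sup.
Qed.
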